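(* Let $q\in\{1,\dots,n-1\}$. Suppose that $\{\sigma_1,\dots,\sigma_k\}-\{\varepsilon_1,\dots,\varepsilon_{n-k}\}$ satisfies condition $(N_a)$, and that $c_q+d_q=n-q$, $c_q=n-q$ and $d_q=0$. Then: - If $n-k$ is even, then $v_s^q[M]$ is nonnegative on $I\times I$ if and only if $M\in(\lambda_1,0]$, where $\lambda_1<0$ is the biggest negative eigenvalue of $T_n[0]$ in $X_{\{\sigma_1,\dots,\sigma_k\}}^{\{\varepsilon_1,\dots,\varepsilon_{n-k}\}}$. - If $n-k$ is odd, then $v_s^q[M]$ is nonnegative on $I\times I$ if and only if $M\in[0,\lambda_1)$, where $\lambda_1>0$ is the least positive eigenvalue of $T_n[0]$ in $X_{\{\sigma_1,\dots,\sigma_k\}}^{\{\varepsilon_1,\dots,\varepsilon_{n-k}\}}$.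
   Context: Let $n\ge 2$, $I=[a,b]$, $M\in\mathbb{R}$, $T_n[M]u=u^{(n)}+Mu$, $k\in\{1,\dots,n-1\}$, and let $0\le\sigma_1<\dots<\sigma_k\le n-1$ and $0\le\varepsilon_1<\dots<\varepsilon_{n-k}\le n-1$ be integers. For sets $A,B\subset\{0,\dots,n-1\}$ let $X_A^B=\{u\in C^n(I): u^{(i)}(a)=0\ \forall i\in A,\ u^{(j)}(b)=0\ \forall j\in B\}$. A number $\lambda\in\mathbb{R}$ is called an eigenvalue of $T_n[0]$ in $X_A^B$ if there is $u\in X_A^B$, $u\not\equiv0$, with $u^{(n)}(t)+\lambda u(t)=0$ on $I$. Condition $(N_a)$: $\#\{j:\sigma_j<h\}+\#\{j:\varepsilon_j<h\}\ge h$ for all $h\in\{1,\dots,n-1\}$. $g_M(t,s)$ denotes the Green's function of $T_n[M]$ in $X_{\{\sigma_1,\dots,\sigma_k\}}^{\{\varepsilon_1,\dots,\varepsilon_{n-k}\}}$ (any assertion about $g_M$ for a given $M$ includes that it exists, i.e. that $M$ is not an eigenvalue of $T_n[0]$ in this space), and $v_s^q[M](t)=\frac{\partial^q}{\partial t^q}g_M(t,s)$ (for $q=n-1$ it is defined for $t\ne s$, with a jump at $t=s$). $c_q=\#\{i:\sigma_i\ge q\}$ and $d_q=\#\{i:\varepsilon_i\ge q\}$. *)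

(* Defs.v *)
From Stdlib Require Import Reals Arith List Sorted.
From Coquelicot Require Import Coquelicot.
Open Scope R_scope.

Definition segment (a b t : R) : Prop := a <= t <= b.

(* Derivative relative to a set [D]: [is_derive] with [locally t] replaced by
   [within D (locally t)]; one-sided at the endpoints of a segment. *)
Definition is_derive_on (D : R -> Prop) (f : R -> R) (t l : R) : Prop :=
  filterdiff f (within D (locally t)) (fun y => scal y l).

(* A function u in C^n([a,b]) is represented by the sequence U 0 = u, U 1 = u',
   ..., U n = u^(n); on [a,b] with a < b these are determined by U 0. *)
Definition Cn (n : nat) (a b : R) (U : nat -> R -> R) : Prop :=
  (forall i t, (i < n)%nat -> segment a b t ->
     is_derive_on (segment a b) (U i) t (U (S i) t)) /\
  continuous_on (segment a b) (U n).

Definition boundary (a b : R) (A B : list nat) (U : nat -> R -> R) : Prop :=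
  (forall i, In i A -> U i a = 0) /\ (forall j, In j B -> U j b = 0).

Definition space_X (n : nat) (a b : R) (A B : list nat) (U : nat -> R -> R) :
    Prop :=
  Cn n a b U /\ boundary a b A B U.

Definition eigenvalue (n : nat) (a b : R) (A B : list nat) (lambda : R) :
    Prop :=
  exists U : nat -> R -> R,
    space_X n a b A B U /\
    (exists t, segment a b t /\ U O t <> 0) /\
    (forall t, segment a b t -> U n t + lambda * U O t = 0).

Definition square (a b : R) (p : R * R) : Prop :=
  segment a b (fst p) /\ segment a b (snd p).

Definition lower_triangle (a b : R) (p : R * R) : Prop :=
  square a b p /\ snd p < fst p.

Definition upper_triangle (a b : R) (p : R * R) : Prop :=
  square a b p /\ fst p < snd p.

(* G i t s is the i-th partial derivative in t of the Green's function
   g = G 0 of u^(n) + M u (for n >= 2).  The values of G (n-1) and G n on the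
   diagonal t = s are meaningless. *)
Definition is_green (n : nat) (a b M : R) (A B : list nat)
    (G : nat -> R -> R -> R) : Prop :=
  (forall i t s, (i < n)%nat -> segment a b t -> segment a b s ->
     (i < n - 2)%nat \/ t <> s ->
     is_derive_on (segment a b) (fun x => G i x s) t (G (S i) t s)) /\
  (forall i, (i <= n - 2)%nat ->
     continuous_on (square a b) (fun p => G i (fst p) (snd p))) /\
  (forall i, i = (n - 1)%nat \/ i = n ->
     continuous_on (lower_triangle a b) (fun p => G i (fst p) (snd p)) /\
     continuous_on (upper_triangle a b) (fun p => G i (fst p) (snd p))) /\
  (forall s, a < s < b ->
     exists l r : R,
       filterlim (fun t => G (n - 1)%nat t s) (at_left s) (locally l) /\
       filterlim (fun t => G (n - 1)%nat t s) (at_right s) (locally r) /\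
       r - l = 1) /\
  (forall t s, segment a b t -> a < s < b -> t <> s ->
     G n t s + M * G O t s = 0) /\
  (forall s, a < s < b -> boundary a b A B (fun i t => G i t s)).

(* Includes the existence of the Green's function, which is unique when M is
   not an eigenvalue. *)
Definition green_derivative_nonneg (n : nat) (a b M : R) (A B : list nat)
    (q : nat) : Prop :=
  ~ eigenvalue n a b A B M /\
  exists G : nat -> R -> R -> R,
    is_green n a b M A B G /\
    (forall t s, segment a b t -> segment a b s ->
       (q = (n - 1)%nat -> t <> s) -> 0 <= G q t s).

Definition biggest_negative_eigenvalue (n : nat) (a b : R) (A B : list nat)
    (lambda : R) : Prop :=
  eigenvalue n a b A B lambda /\ lambda < 0 /\
  (forall mu, eigenvalue n a b A B mu -> mu < 0 -> mu <= lambda).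

Definition least_positive_eigenvalue (n : nat) (a b : R) (A B : list nat)
    (lambda : R) : Prop :=
  eigenvalue n a b A B lambda /\ 0 < lambda /\
  (forall mu, eigenvalue n a b A B mu -> 0 < mu -> lambda <= mu).

Definition increasing_indices (n m : nat) (l : list nat) : Prop :=
  length l = m /\ Sorted lt l /\ List.Forall (fun i => (i <= n - 1)%nat) l.

Definition count_lt (h : nat) (l : list nat) : nat :=
  length (filter (fun i => Nat.ltb i h) l).

Definition count_ge (h : nat) (l : list nat) : nat :=
  length (filter (fun i => Nat.leb h i) l).

Definition condition_Na (n : nat) (sigma eps : list nat) : Prop :=
  forall h, (1 <= h <= n - 1)%nat ->
    (h <= count_lt h sigma + count_lt h eps)%nat.

(* Main.v *)
(* With m = n - k, e = (-1)^m and M = - e mu, solving u^(n) + M u = h amounts to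
   w = P h + mu P w for w = e u, where P is e times the Green operator for M = 0.
   Counting sign changes by Rolle's theorem shows P >= 0.  The parameters mu >= 0 for
   which w = P 1 + mu P w has a nonnegative solution w form an interval [0, mu1):
   such a w excludes eigenvalues up to mu and forces every Green operator up to mu
   to be nonnegative, since a bound u >= - C w improves itself to
   u >= - C (1 - eta) w; and if the supremum of the interval were not an eigenvalue, an
   a priori estimate there would allow the interval to be extended.
   Hence mu1 gives the first eigenvalue.

   As all the conditions of order at least q sit at a, u^(q) is an iterated integral
   of u^(n) from a, while u is recovered from u^(q) by a problem of order q of the
   same kind.  So a nonnegative u^(n) = h + mu w gives u^(q) >= 0, and u^(q) >= 0
   gives w >= 0.  For mu < 0 the sign of u^(n) before the support of h is opposite,
   which would make u vanish there. *)
Require Import Defs.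
From Stdlib Require Import Reals Lra Lia Psatz Arith List Sorted Classical.
From Coquelicot Require Import Coquelicot.
Open Scope R_scope.

(** * Derivatives on a segment *)

(** No integral is formed: the Green operator enters only through explicit solutions. The Green's
    function is not of class C^n, so the comparison arguments do not apply to it; they are applied
    to the solution with load max(t - s, 0), which is of class C^n and whose second derivative in
    the source s is, off the diagonal, the Green's function. Signs pass from this solution to the
    Green's function through second differences in s, whose loads are tents, and back through
    monotonicity in s starting at s = b, where the responses vanish.

    The interval of admissible mu is bounded because of a feedback: u^(q)(s) bounds w from below
    before s, and mu w in turn feeds u^(q)(s), so that a large mu would make u^(q)(s) exceed itself.
    The loop closes because a load supported after s already produces a nonzero solution before s,
    which is where a condition at b enters.

    How far the interval extends beyond a given mu is controlled by a bound r of w alone: a step of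
    1 / (2 (r + 1)) is always possible. *)

Definition cont_in (D : R -> Prop) (f : R -> R) (t : R) : Prop :=
  filterlim f (within D (locally t)) (locally (f t)).

Lemma cont_in_eps D f t :
  cont_in D f t <->
  forall e, 0 < e -> exists d, 0 < d /\
    forall y, D y -> Rabs (y - t) < d -> Rabs (f y - f t) < e.
Proof.
split.
- intros H e he.
  destruct (H (ball (f t) (mkposreal e he)) (locally_ball (f t) _)) as [d Hd].
  exists d; split; [apply cond_pos | intros y Dy Hy; exact (Hd y Hy Dy)].
- intros H P [e He].
  destruct (H e (cond_pos e)) as [d [hd Hd]].
  exists (mkposreal d hd); intros y Hy Dy; apply He; exact (Hd y Dy Hy).
Qed.

Lemma is_derive_on_eps (D : R -> Prop) f t l (Dt : D t) :
  is_derive_on D f t l <->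
  forall e, 0 < e -> exists d, 0 < d /\
    forall y, D y -> Rabs (y - t) < d ->
      Rabs (f y - f t - (y - t) * l) <= e * Rabs (y - t).
Proof.
split.
- intros [_ H] e he.
  assert (Hlim : is_filter_lim (within D (locally t)) t).
  { intros P [d Hd]; exists d; intros y Hy _; now apply Hd. }
  destruct (H t Hlim (mkposreal e he)) as [d Hd].
  exists d; split; [apply cond_pos|].
  intros y Dy Hy; exact (Hd y Hy Dy).
- intros H; split; [apply (is_linear_scal_l (K := R_AbsRing) (V := R_NormedModule) l)|].
  intros x Hx.
  (* [filterdiff] quantifies over all limits of the filter. As t lies in D, every set of the filter
     contains t, so no other point can be a limit. *)
  assert (x = t) as ->.
  { destruct (Req_dec x t) as [E|E]; [exact E|exfalso].
    assert (hp : 0 < Rabs (t - x)) by (apply Rabs_pos_lt; lra).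
    destruct (Hx (ball x (mkposreal _ hp)) (locally_ball x _)) as [d Hd].
    specialize (Hd t (ball_center t d) Dt).
    unfold ball in Hd; simpl in Hd; unfold AbsRing_ball, abs, minus, plus, opp in Hd.
    simpl in Hd; unfold Rminus in Hd; lra. }
  intros e; destruct (H e (cond_pos e)) as [d [hd Hd]].
  exists (mkposreal d hd); intros y Hy Dy; exact (Hd y Dy Hy).
Qed.

Lemma is_derive_derive_on (D : R -> Prop) f t l :
  D t -> is_derive f t l -> is_derive_on D f t l.
Proof.
intros Dt [_ H]; apply is_derive_on_eps; [exact Dt|].
intros e he.
destruct (H t (fun P HP => HP) (mkposreal e he)) as [d Hd].
exists d; split; [apply cond_pos|].
intros y _ Hy; exact (Hd y Hy).
Qed.

Lemma is_derive_on_interior a b f t l :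
  a < t < b -> is_derive_on (segment a b) f t l -> is_derive f t l.
Proof.
intros ht H.
split; [apply (is_linear_scal_l (K := R_AbsRing) (V := R_NormedModule) l)|].
intros x Hx.
apply (is_filter_lim_locally_unique (K := R_AbsRing) (V := R_NormedModule)) in Hx.
subst x; intros e.
assert (Dt : segment a b t) by (split; lra).
rewrite (is_derive_on_eps _ _ _ _ Dt) in H.
destruct (H e (cond_pos e)) as [d [hd Hd]].
assert (hm : 0 < Rmin d (Rmin (t - a) (b - t))) by
  (repeat apply Rmin_glb_lt; lra).
exists (mkposreal _ hm); intros y Hy.
change (Rabs (y - t) < Rmin d (Rmin (t - a) (b - t))) in Hy.
apply Hd; [split|].
- apply Rmin_Rgt_l in Hy as [_ Hy]; apply Rmin_Rgt_l in Hy as [Hy _].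
  apply Rabs_def2 in Hy; lra.
- apply Rmin_Rgt_l in Hy as [_ Hy]; apply Rmin_Rgt_l in Hy as [_ Hy].
  apply Rabs_def2 in Hy; lra.
- now apply Rmin_Rgt_l in Hy.
Qed.

Lemma is_derive_on_subset (D E : R -> Prop) f t l :
  E t -> (forall x, E x -> D x) -> is_derive_on D f t l -> is_derive_on E f t l.
Proof.
intros Et HED H.
rewrite (is_derive_on_eps _ _ _ _ (HED t Et)) in H.
apply is_derive_on_eps; [exact Et|].
intros e he; destruct (H e he) as [d [hd Hd]].
exists d; split; [exact hd|]; intros y Ey; apply Hd; now apply HED.
Qed.

Lemma is_derive_on_ext_loc (D : R -> Prop) f g t l r :
  D t -> 0 < r -> (forall y, D y -> Rabs (y - t) < r -> f y = g y) ->
  is_derive_on D f t l -> is_derive_on D g t l.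
Proof.
intros Dt hr Hfg H.
rewrite (is_derive_on_eps _ _ _ _ Dt) in H.
apply is_derive_on_eps; [exact Dt|].
intros e he; destruct (H e he) as [d [hd Hd]].
exists (Rmin d r); split; [now apply Rmin_glb_lt|].
intros y Dy Hy; apply Rmin_Rgt_l in Hy as [Hy1 Hy2].
rewrite <- (Hfg y Dy Hy2), <- (Hfg t Dt); [now apply Hd|].
now rewrite Rminus_diag, Rabs_R0.
Qed.

Lemma is_derive_on_ext (D : R -> Prop) f g t l :
  D t -> (forall y, D y -> f y = g y) ->
  is_derive_on D f t l -> is_derive_on D g t l.
Proof.
intros Dt Hfg; apply (is_derive_on_ext_loc D f g t l 1 Dt Rlt_0_1).
intros y Dy _; now apply Hfg.
Qed.

Lemma is_derive_on_plus D f g t l m :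
  is_derive_on D f t l -> is_derive_on D g t m ->
  is_derive_on D (fun x => f x + g x) t (l + m).
Proof.
intros Hf Hg.
apply (filterdiff_ext_lin _ _ _ (filterdiff_plus_fct _ _ _ _ Hf Hg)).
intros y; symmetry; exact (scal_distr_l (K := R_AbsRing) y l m).
Qed.

Lemma is_derive_on_scal D f t l k :
  is_derive_on D f t l -> is_derive_on D (fun x => k * f x) t (k * l).
Proof.
intros Hf.
apply (filterdiff_ext_lin _ _ _ (filterdiff_scal_r_fct k _ _ Rmult_comm Hf)).
intros y; unfold scal; simpl; unfold mult; simpl; ring.
Qed.

Lemma is_derive_on_cont (D : R -> Prop) f t l :
  D t -> is_derive_on D f t l -> cont_in D f t.
Proof.
intros Dt H; rewrite (is_derive_on_eps _ _ _ _ Dt) in H.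
apply cont_in_eps; intros e he.
destruct (H 1 Rlt_0_1) as [d [hd Hd]].
pose proof (Rabs_pos l) as hl.
assert (hq : 0 < e / (2 + Rabs l)) by (apply Rdiv_lt_0_compat; lra).
exists (Rmin d (e / (2 + Rabs l))); split; [now apply Rmin_glb_lt|].
intros y Dy Hy; apply Rmin_Rgt_l in Hy as [Hy1 Hy2].
specialize (Hd y Dy Hy1); rewrite Rmult_1_l in Hd.
replace (f y - f t) with ((f y - f t - (y - t) * l) + (y - t) * l) by ring.
eapply Rle_lt_trans; [apply Rabs_triang|].
rewrite Rabs_mult.
apply Rmult_gt_compat_l with (r := 2 + Rabs l) in Hy2; [|lra].
replace ((2 + Rabs l) * (e / (2 + Rabs l))) with e in Hy2 by (field; lra).
pose proof (Rabs_pos (y - t)); nra.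
Qed.

Lemma cont_in_subset (D E : R -> Prop) f t :
  (forall x, E x -> D x) -> cont_in D f t -> cont_in E f t.
Proof.
intros HED H; apply cont_in_eps; intros e he.
destruct (proj1 (cont_in_eps _ _ _) H e he) as [d [hd Hd]].
exists d; split; [exact hd|]; intros y Ey; apply Hd; now apply HED.
Qed.

Lemma continuous_cont_in D f t : continuous f t -> cont_in D f t.
Proof.
intros H P HP; specialize (H P HP).
unfold filtermap, within in *; revert H; apply filter_imp; auto.
Qed.

(** Composition with the projection onto [x, y], which is 1-Lipschitz, turns continuity relative to
    the segment into continuity on the line, the form in which the mean value and extreme value
    theorems are stated. *)
Lemma clamp_continuity x y f :
  x <= y -> (forall t, segment x y t -> cont_in (segment x y) f t) ->
  forall t, continuity_pt (fun z => f (Rmax x (Rmin y z))) t.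
Proof.
intros hxy H t.
apply continuity_pt_locally; intros e.
assert (Hc : forall z, segment x y (Rmax x (Rmin y z))).
{ intros z; split; [apply Rmax_l|].
  apply Rmax_lub; [exact hxy|apply Rmin_l]. }
destruct (proj1 (cont_in_eps _ _ _) (H _ (Hc t)) e (cond_pos e)) as [d [hd Hd]].
exists (mkposreal d hd); intros z Hz.
apply Hd; [apply Hc|].
change (Rabs (z - t) < d) in Hz.
eapply Rle_lt_trans; [|exact Hz].
unfold Rmax, Rmin;
  repeat destruct Rle_dec; unfold Rabs; repeat destruct Rcase_abs; lra.
Qed.

Lemma mvt_segment x y f f' :
  x < y -> (forall t, segment x y t -> cont_in (segment x y) f t) ->
  (forall t, x < t < y -> is_derive f t (f' t)) ->
  exists t, x < t < y /\ f y - f x = f' t * (y - x).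
Proof.
intros hxy Hc Hd.
set (g := fun z => f (Rmax x (Rmin y z))).
assert (Hg : forall t, x <= t <= y -> g t = f t).
{ intros t ht; unfold g; rewrite Rmin_right, Rmax_right; lra. }
assert (Hgd : forall t, x < t < y -> derivable_pt_lim g t (f' t)).
{ intros t ht; apply is_derive_Reals.
  apply is_derive_ext_loc with (f := f); [|now apply Hd].
  apply (locally_interval _ t (Finite x) (Finite y)); simpl; try lra.
  intros z hz1 hz2; symmetry; apply Hg; lra. }
pose (pr1 := fun t (P : x < t < y) => exist (derivable_pt_abs g t) (f' t) (Hgd t P)).
pose (pr2 := fun t (_ : x < t < y) =>
  exist (derivable_pt_abs (fun z => z) t) 1 (derivable_pt_lim_id t)).
destruct (MVT g (fun z => z) x y pr1 pr2 hxy) as [t [P E]].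
- intros; now apply clamp_continuity; [left|].
- intros; apply derivable_continuous_pt, derivable_pt_id.
- exists t; split; [exact P|]; simpl in E.
  rewrite !Hg in E by lra; lra.
Qed.

Lemma mvt_on a b f f' x y :
  (forall t, segment a b t -> is_derive_on (segment a b) f t (f' t)) ->
  a <= x -> x < y -> y <= b ->
  exists t, x < t < y /\ f y - f x = f' t * (y - x).
Proof.
intros H hx hxy hy.
apply mvt_segment; [exact hxy| |].
- intros t [h1 h2]; apply cont_in_subset with (segment a b).
  + intros z [h3 h4]; split; lra.
  + apply is_derive_on_cont with (f' t); [|apply H]; split; lra.
- intros t ht; apply is_derive_on_interior with a b; [lra|apply H; split; lra].
Qed.

Lemma increasing_on a b f f' x y :
  (forall t, segment a b t -> is_derive_on (segment a b) f t (f' t)) ->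
  a <= x -> x <= y -> y <= b -> (forall t, x <= t <= y -> 0 <= f' t) ->
  f x <= f y.
Proof.
intros H hx [hxy|<-] hy Hp; [|lra].
destruct (mvt_on a b f f' x y H hx hxy hy) as [t [ht E]].
assert (0 <= f' t) by (apply Hp; lra); nra.
Qed.

Lemma is_derive_on_unique a b f g t l m :
  a < b -> segment a b t -> (forall x, segment a b x -> f x = g x) ->
  is_derive_on (segment a b) f t l -> is_derive_on (segment a b) g t m -> l = m.
Proof.
intros hab ht Hfg Hf Hg.
apply (is_derive_on_ext _ f g) in Hf; [|exact ht|exact Hfg].
rewrite (is_derive_on_eps _ _ _ _ ht) in Hf.
rewrite (is_derive_on_eps _ _ _ _ ht) in Hg.
apply NNPP; intros hne.
assert (he : 0 < Rabs (l - m) / 4) by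
  (assert (0 < Rabs (l - m)) by (apply Rabs_pos_lt; lra); lra).
destruct (Hf _ he) as [d1 [hd1 H1]]; destruct (Hg _ he) as [d2 [hd2 H2]].
assert (Hy : exists y, segment a b y /\ y <> t /\ Rabs (y - t) < Rmin d1 d2).
{ assert (hd : 0 < Rmin d1 d2) by now apply Rmin_glb_lt.
  (* A step of at most half the length of the segment stays inside it in at least one direction. *)
  set (d := Rmin (Rmin d1 d2) (b - a) / 2).
  assert (hd' : 0 < Rmin (Rmin d1 d2) (b - a)) by (apply Rmin_glb_lt; lra).
  pose proof (Rmin_l (Rmin d1 d2) (b - a)); pose proof (Rmin_r (Rmin d1 d2) (b - a)).
  destruct ht as [h1 h2].
  destruct (Rle_dec (t + d) b).
  - exists (t + d); repeat split; unfold d in *; try lra.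
    replace (_ - t) with (Rmin (Rmin d1 d2) (b - a) / 2) by ring.
    rewrite Rabs_pos_eq; lra.
  - exists (t - d); repeat split; unfold d in *; try lra.
    replace (_ - t) with (- (Rmin (Rmin d1 d2) (b - a) / 2)) by ring.
    rewrite Rabs_Ropp, Rabs_pos_eq; lra. }
destruct Hy as [y [hy [hyt Hyd]]]; apply Rmin_Rgt_l in Hyd as [Hy1 Hy2].
specialize (H1 y hy Hy1); specialize (H2 y hy Hy2).
assert (hp : 0 < Rabs (y - t)) by (apply Rabs_pos_lt; lra).
assert (K : Rabs ((y - t) * (l - m)) <= 2 * (Rabs (l - m) / 4 * Rabs (y - t))).
{ replace ((y - t) * (l - m)) with
    ((g y - g t - (y - t) * m) - (g y - g t - (y - t) * l)) by ring.
  eapply Rle_trans; [apply Rabs_triang|]; rewrite Rabs_Ropp; lra. }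
rewrite Rabs_mult in K; nra.
Qed.

Lemma cont_in_bounded a b f :
  a <= b -> (forall t, segment a b t -> cont_in (segment a b) f t) ->
  exists r, 0 <= r /\ forall t, segment a b t -> Rabs (f t) <= r.
Proof.
intros hab H.
set (g := fun z => Rabs (f (Rmax a (Rmin b z)))).
destruct (continuity_ab_maj g a b hab) as [x [Hx _]].
- intros c _; apply (continuity_pt_comp (fun z => f (Rmax a (Rmin b z))) Rabs).
  + now apply clamp_continuity.
  + apply Rcontinuity_abs.
- exists (g x); split; [apply Rabs_pos|].
  intros t ht; specialize (Hx t ht); unfold g at 1 in Hx.
  rewrite Rmin_right, Rmax_right in Hx by (destruct ht; lra); exact Hx.
Qed.

(** * Sign of the solutions for M = 0 *)

(** Sign changes are counted by a list of witnesses. The order is weak, since opposite strict signs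
    already keep neighbours apart; of [s] only the sign matters. *)
Fixpoint alternating (f : R -> R) (s x y : R) (l : list R) : Prop :=
  match l with
  | nil => True
  | t :: l' => x <= t <= y /\ 0 < s * f t /\ alternating f (- s) t y l'
  end.

Lemma alternating_weaken f s x x' y l :
  x' <= x -> alternating f s x y l -> alternating f s x' y l.
Proof. destruct l; simpl; [auto|]; intros hx [h [h1 h2]]; repeat split; auto; lra. Qed.

(* Rolle's theorem for sign changes; a zero of [f] at [b] counts as one more. *)
Lemma alternating_derive a b f f' (z : bool) :
  (forall t, segment a b t -> is_derive_on (segment a b) f t (f' t)) ->
  (z = true -> f b = 0) ->
  forall l s x, a <= x <= b ->
  s * f x < 0 \/ (s * f x <= 0 /\ l <> nil) ->
  alternating f s x b l ->
  exists l', alternating f' s x b l' /\ length l' = (length l + Nat.b2n z)%nat.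
Proof.
intros Hd Hz l; induction l as [|t l IH]; intros s x hx Hs Hl.
- destruct Hs as [Hs|[_ Hs]]; [|now destruct Hs].
  destruct z; [|now exists nil].
  specialize (Hz eq_refl).
  destruct (mvt_on a b f f' x b Hd) as [t [ht E]]; try lra.
  { destruct (Req_dec x b) as [->|]; [rewrite Hz in Hs; lra|lra]. }
  exists (t :: nil); simpl; repeat split; try lra.
  assert (0 < s * f' t * (b - x)) by (rewrite Rmult_assoc, <- E, Hz; lra).
  apply Rmult_lt_reg_r with (b - x); lra.
- destruct Hl as [ht [hft Hl]].
  assert (hs : s * f x <= 0) by lra.
  assert (hxt : x < t).
  { destruct (Req_dec x t) as [->|]; lra. }
  destruct (mvt_on a b f f' x t Hd) as [u [hu E]]; try lra.
  destruct (IH (- s) t) as [l' [Hl' El']]; [lra|left; lra|exact Hl|].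
  exists (u :: l'); simpl; repeat split; try lra.
  + assert (0 < s * f' u * (t - x)) by (rewrite Rmult_assoc, <- E; lra).
    apply Rmult_lt_reg_r with (t - x); lra.
  + apply alternating_weaken with t; [lra|exact Hl'].
  + now rewrite El'.
Qed.

Definition mem (h : nat) (l : list nat) : bool :=
  if in_dec Nat.eq_dec h l then true else false.

Lemma mem_in h l : mem h l = true -> In h l.
Proof. unfold mem; now destruct in_dec. Qed.

Lemma count_lt_S h l :
  NoDup l -> count_lt (S h) l = (count_lt h l + Nat.b2n (mem h l))%nat.
Proof.
unfold count_lt, mem; intros Hl; induction Hl as [|x l Hx Hl IH]; [reflexivity|].
simpl filter.
destruct (Nat.eq_dec x h) as [<-|hne].
- rewrite (proj2 (Nat.ltb_lt x (S x))), Nat.ltb_irrefl by lia; simpl length; rewrite IH.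
  destruct (in_dec Nat.eq_dec x l); [tauto|].
  destruct (in_dec Nat.eq_dec x (x :: l)) as [|K]; simpl in *; [lia|tauto].
- replace (x <? S h) with (x <? h)
    by (destruct (Nat.ltb_spec x h), (Nat.ltb_spec x (S h)); lia).
  replace (Nat.b2n (if in_dec Nat.eq_dec h (x :: l) then true else false))
    with (Nat.b2n (if in_dec Nat.eq_dec h l then true else false)).
  { destruct (x <? h); simpl length; rewrite IH; lia. }
  destruct (in_dec Nat.eq_dec h l), (in_dec Nat.eq_dec h (x :: l)) as [K|K];
    simpl in *; try reflexivity; tauto.
Qed.

Lemma count_lt_0 l : count_lt 0 l = 0%nat.
Proof. unfold count_lt; induction l as [|x l IH]; [reflexivity|exact IH]. Qed.

Lemma count_lt_all n l :
  (forall i, In i l -> (i < n)%nat) -> count_lt n l = length l.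
Proof.
unfold count_lt; induction l as [|x l IH]; intros H; [reflexivity|].
simpl filter; rewrite (proj2 (Nat.ltb_lt x n)) by (apply H; now left).
simpl; rewrite IH; [reflexivity|]; intros; apply H; now right.
Qed.

Definition admissible (n : nat) (A B : list nat) : Prop :=
  NoDup A /\ NoDup B /\ (forall i, In i A -> (i < n)%nat) /\
  (forall i, In i B -> (i < n)%nat) /\ (length A + length B = n)%nat /\
  condition_Na n A B.

(** Passing to the next derivative costs one witness, which a zero at a gives back, and a zero at b
    adds another; hence the length. The sign of the first witness flips unless the derivative
    vanishes at a; hence the exponent. *)
Lemma alternating_Cn n a b A B U :
  admissible n A B -> space_X n a b A B U ->
  (exists t, segment a b t /\ U O t < 0) ->
  forall h, (h <= n)%nat ->
  exists l, alternating (U h) (- (-1) ^ (h + count_lt h A)) a b l /\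
    (length l + h = 1 + count_lt h A + count_lt h B)%nat.
Proof.
intros (HA & HB & _ & _ & _ & HN) [[Hd _] [Ha Hb]] [t [ht Ht]] h.
induction h as [|h IH]; intros hn.
- exists (t :: nil); rewrite !count_lt_0; simpl; destruct ht; repeat split; auto; lra.
- destruct IH as [l [Hl El]]; [lia|].
  (* This is the role of condition (N_a): the witnesses never run out before order n. *)
  assert (hl : (1 <= length l)%nat).
  { destruct h; [rewrite !count_lt_0 in El; lia|].
    specialize (HN (S h)); lia. }
  assert (HUd : forall t, segment a b t ->
    is_derive_on (segment a b) (U h) t (U (S h) t)) by (intros; apply Hd; auto; lia).
  rewrite !count_lt_S by assumption.
  assert (Hz : mem h B = true -> U h b = 0) by (intros E; apply Hb, mem_in, E).
  destruct (mem h A) eqn:EA.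
  + apply mem_in, Ha in EA.
    destruct (alternating_derive a b (U h) (U (S h)) _ HUd Hz l _ a
      ltac:(destruct ht; lra) ltac:(right; rewrite EA; split; [lra|now intros ->; simpl in hl; lia]) Hl)
      as [l' [Hl' El']].
    exists l'; split; [|simpl Nat.b2n; lia].
    replace (S h + (count_lt h A + Nat.b2n true))%nat with (2 + (h + count_lt h A))%nat
      by (simpl Nat.b2n; lia).
    rewrite pow_add; replace ((-1) ^ 2) with 1 by ring; now rewrite Rmult_1_l.
  (* Without a zero at a, the first witness becomes the starting point and is given up; the rest
     begins with the opposite sign. *)
  + destruct l as [|u l]; [simpl in hl; lia|]; destruct Hl as [hu [Hu Hl]].
    destruct (alternating_derive a b (U h) (U (S h)) _ HUd Hz l
      (- - (-1) ^ (h + count_lt h A)) u hu ltac:(left; lra) Hl) as [l' [Hl' El']].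
    exists l'; split; [|simpl in *; lia].
    apply alternating_weaken with u; [lra|].
    replace (S h + (count_lt h A + Nat.b2n false))%nat with (S (h + count_lt h A))
      by (simpl Nat.b2n; lia).
    rewrite <- tech_pow_Rmult.
    now replace (- (-1 * (-1) ^ (h + count_lt h A))) with
      (- - (-1) ^ (h + count_lt h A)) by ring.
Qed.

(** A negative value of u leaves, after n derivatives, exactly one witness, where (-1)^(n + |A|)
    u^(n) is negative; as n + |A| has the parity of |B|, this contradicts the hypothesis. *)
Lemma positivity n a b A B U :
  admissible n A B -> space_X n a b A B U ->
  (forall t, segment a b t -> 0 <= (-1) ^ length B * U n t) ->
  forall t, segment a b t -> 0 <= U O t.
Proof.
intros HAB HU Hn t ht.
destruct (Rle_lt_dec 0 (U O t)) as [|Hlt]; [assumption|exfalso].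
destruct (alternating_Cn n a b A B U HAB HU (ex_intro _ t (conj ht Hlt)) n (le_n n))
  as [l [Hl El]].
destruct HAB as (_ & _ & HA & HB & HAB & _).
rewrite !count_lt_all in * by assumption.
destruct l as [|u l]; [simpl in El; lia|]; destruct Hl as [hu [Hu _]].
specialize (Hn u hu).
replace (n + length A)%nat with (2 * length A + length B)%nat in Hu by lia.
rewrite pow_add, pow_1_even in Hu; lra.
Qed.

(** * Fundamental solutions *)

(* [kappa n c p] is the p-th derivative at 0 of the solution [K] of
   [u^(n) = c u + x] with zero initial data; [fund n c p] is [K^(p)]. *)
Definition kappa (n : nat) (c : R) (p : nat) : R :=
  if andb (n <? p) ((p - 1) mod n =? 0) then c ^ ((p - 1) / n - 1) else 0.

Definition fund (n : nat) (c : R) (p : nat) (x : R) : R :=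
  PSeries (fun l => kappa n c (l + p) / INR (fact l)) x.

Lemma kappa_small n c p : (p <= n)%nat -> kappa n c p = 0.
Proof.
intros h; unfold kappa; now rewrite (proj2 (Nat.ltb_ge n p) h).
Qed.

Lemma kappa_Sn n c : (1 <= n)%nat -> kappa n c (S n) = 1.
Proof.
intros h; unfold kappa.
rewrite (proj2 (Nat.ltb_lt n (S n))), Nat.sub_succ, Nat.sub_0_r, Nat.Div0.mod_same,
  Nat.div_same by lia; reflexivity.
Qed.

(** The recursion u^(n) = c u at 0. The index p = 1 is excluded because there the source x
    contributes the extra 1 of [kappa_Sn]. *)
Lemma kappa_shift n c p :
  (1 <= n)%nat -> (2 <= p)%nat -> kappa n c (p + n) = c * kappa n c p.
Proof.
intros hn hp; unfold kappa.
rewrite (proj2 (Nat.ltb_lt n (p + n))) by lia.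
replace (p + n - 1)%nat with ((p - 1) + 1 * n)%nat by lia.
rewrite Nat.Div0.mod_add, Nat.div_add by lia.
destruct (Nat.eqb_spec ((p - 1) mod n) 0) as [E|E]; simpl; rewrite ?Bool.andb_false_r, ?Bool.andb_true_r;
  [|ring].
pose proof (Nat.div_mod (p - 1) n ltac:(lia)) as D; rewrite E in D.
destruct (Nat.ltb_spec n p).
- destruct ((p - 1) / n)%nat as [|d] eqn:Ed; [nia|].
  replace (S d + 1 - 1)%nat with (S (S d - 1)) by lia; reflexivity.
- exfalso; destruct ((p - 1) / n)%nat as [|d]; nia.
Qed.

Lemma kappa_mid n c p :
  (n < p)%nat -> (p <= 2 * n)%nat -> p <> S n -> kappa n c p = 0.
Proof.
intros h1 h2 h3; unfold kappa.
rewrite (proj2 (Nat.ltb_lt n p) h1); simpl.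
replace (p - 1)%nat with ((p - 1 - n) + 1 * n)%nat by lia.
rewrite Nat.Div0.mod_add, Nat.mod_small by lia.
destruct (Nat.eqb_spec (p - 1 - n) 0); [lia|reflexivity].
Qed.

Lemma kappa_bound n c p : (1 <= n)%nat -> Rabs (kappa n c p) <= (1 + Rabs c) ^ p.
Proof.
intros hn; pose proof (Rabs_pos c); unfold kappa.
destruct (andb _ _).
- rewrite <- RPow_abs; eapply Rle_trans.
  + apply pow_incr with (y := 1 + Rabs c); lra.
  + apply Rle_pow; [lra|].
    pose proof (Nat.Div0.div_le_upper_bound (p - 1) n (p - 1) ltac:(nia)); lia.
- rewrite Rabs_R0; apply pow_le; lra.
Qed.

(** By [kappa_bound] the terms at y are dominated by a multiple of the exponential series at A y;
    taking y = |x| + 1 makes the inequality strict. *)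
Lemma fund_radius n c p x :
  (1 <= n)%nat ->
  Rbar_lt (Rabs x) (CV_radius (fun l => kappa n c (l + p) / INR (fact l))).
Proof.
intros hn.
set (A := 1 + Rabs c); assert (hA : 0 < A) by (pose proof (Rabs_pos c); unfold A; lra).
set (y := Rabs x + 1); assert (hy : 0 < y) by (pose proof (Rabs_pos x); unfold y; lra).
apply Rbar_lt_le_trans with (Finite y); [unfold y; simpl; lra|].
apply (proj1 (Lub_Rbar_correct (CV_disk _))).
apply (ex_series_le (K := R_AbsRing) (V := R_CompleteNormedModule) _
  (fun l => A ^ p * (/ INR (fact l) * (A * y) ^ l))).
- intros l; unfold norm; simpl; unfold abs; simpl.
  rewrite Rabs_Rabsolu, Rabs_mult; unfold Rdiv; rewrite Rabs_mult.
  pose proof (INR_fact_lt_0 l) as hf; pose proof (Rinv_0_lt_compat _ hf).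
  rewrite (Rabs_pos_eq (/ _)), (Rabs_pos_eq (y ^ l)) by (try apply pow_le; lra).
  rewrite Rpow_mult_distr.
  pose proof (kappa_bound n c (l + p) hn) as hk; fold A in hk; rewrite pow_add in hk.
  replace (A ^ p * (/ INR (fact l) * (A ^ l * y ^ l))) with
    (A ^ l * A ^ p * (/ INR (fact l) * y ^ l)) by ring.
  rewrite Rmult_assoc; apply Rmult_le_compat_r; [|exact hk].
  apply Rmult_le_pos; [lra|apply pow_le; lra].
- apply (ex_series_scal (K := R_AbsRing) (V := R_NormedModule) (A ^ p)).

  eexists; eapply is_series_ext; [|exact (is_exp_Reals (A * y))].
  intros l; simpl; rewrite pow_n_pow; unfold scal; simpl; unfold mult; simpl; ring.
Qed.

Lemma fund_derive n c p x :
  (1 <= n)%nat -> is_derive (fund n c p) x (fund n c (S p) x).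
Proof.
intros hn; unfold fund at 2.
evar_last.
- apply is_derive_PSeries, fund_radius, hn.
- apply PSeries_ext; intros l; unfold PS_derive.
  replace (S l + p)%nat with (l + S p)%nat by lia.
  rewrite fact_simpl, mult_INR; field; split; [apply INR_fact_neq_0|apply not_0_INR; lia].
Qed.

Lemma fund_0 n c p : fund n c p 0 = kappa n c p.
Proof. unfold fund; rewrite PSeries_0; simpl; field. Qed.

Lemma fund_shift n c p x :
  (1 <= n)%nat -> (2 <= p)%nat -> fund n c (n + p) x = c * fund n c p x.
Proof.
intros hn hp; unfold fund; rewrite <- PSeries_scal; apply PSeries_ext; intros l.
unfold PS_scal, scal; simpl; unfold mult; simpl.
replace (l + (n + p))%nat with ((l + p) + n)%nat by lia.
rewrite kappa_shift by lia; unfold Rdiv; ring.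
Qed.

Lemma derive_zero_const (f : R -> R) x :
  (forall t, is_derive f t 0) -> f x = f 0.
Proof.
intros H; destruct (Req_dec x 0) as [->|hx]; [reflexivity|].
destruct (MVT_gen f 0 x (fun _ => 0)) as [t [_ E]].
- intros; apply H.
- intros t _; apply continuity_pt_filterlim.
  apply (ex_derive_continuous (K := R_AbsRing) (V := R_NormedModule)).
  exists 0; apply H.
- lra.
Qed.

(** The two sides have the same derivative by [fund_shift], and their values at 0 are read off
    [kappa]. One more integration of the same kind gives [fund_shift0]. *)
Lemma fund_shift1 n c x :
  (1 <= n)%nat -> fund n c (n + 1) x = c * fund n c 1 x + 1.
Proof.
intros hn.
enough (fund n c (n + 1) x - c * fund n c 1 x = 1) by lra.
rewrite (derive_zero_const (fun t => fund n c (n + 1) t - c * fund n c 1 t)).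
- rewrite !fund_0, (kappa_small n c 1) by lia.
  replace (n + 1)%nat with (S n) by lia; rewrite kappa_Sn by lia; ring.
- intros t; evar_last.
  + apply (is_derive_minus (K := R_AbsRing) (V := R_NormedModule)
      (fund n c (n + 1)) (fun t => c * fund n c 1 t)); [apply fund_derive, hn|].
    apply is_derive_scal, fund_derive, hn.
  + replace (S (n + 1)) with (n + 2)%nat by lia.
    unfold minus, plus, opp; simpl; rewrite fund_shift by lia; ring.
Qed.

Lemma fund_shift0 n c x :
  (1 <= n)%nat -> fund n c n x = c * fund n c 0 x + x.
Proof.
intros hn.
enough (fund n c n x - c * fund n c 0 x - x = 0) by lra.
rewrite (derive_zero_const (fun t => fund n c n t - c * fund n c 0 t - t)).
- rewrite !fund_0, !kappa_small by lia; ring.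
- intros t; evar_last.
  + apply (is_derive_minus (K := R_AbsRing) (V := R_NormedModule)
      (fun t => fund n c n t - c * fund n c 0 t) (fun t => t)).
    * apply (is_derive_minus (K := R_AbsRing) (V := R_NormedModule)
        (fund n c n) (fun t => c * fund n c 0 t)); [apply fund_derive, hn|].
      apply is_derive_scal, fund_derive, hn.
    * apply (is_derive_id (K := R_AbsRing)).
  + replace (S n) with (n + 1)%nat by lia.
    unfold minus, plus, opp, one; simpl; rewrite fund_shift1 by lia; ring.
Qed.

Lemma fund_continuous n c p x : (1 <= n)%nat -> continuous (fund n c p) x.
Proof. 
intros hn; apply (ex_derive_continuous (K := R_AbsRing) (V := R_NormedModule)).
eexists; now apply fund_derive. Qed.

(** K^(n+1) equals 1 at 0 and stays positive on some [0, d); the lower derivatives vanish at 0, so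
    positivity descends through them on the same interval. *)
Lemma fund_pos n c :
  (1 <= n)%nat ->
  exists d, 0 < d /\ forall p x, (p <= S n)%nat -> 0 < x < d -> 0 < fund n c p x.
Proof.
intros hn.
assert (H1 : 0 < fund n c (S n) 0) by (rewrite fund_0, kappa_Sn by lia; lra).
destruct (continuity_pt_locally (fund n c (S n)) 0) as [H _].
destruct (H (proj2 (continuity_pt_filterlim _ _) (fund_continuous n c (S n) 0 hn))
  (mkposreal _ H1)) as [d Hd].
exists d; split; [apply cond_pos|].
assert (Htop : forall x, 0 <= x < d -> 0 < fund n c (S n) x).
{ intros x hx.
  assert (hb : ball 0 d x) by
    (change (Rabs (x - 0) < d); rewrite Rminus_0_r, Rabs_pos_eq; lra).
  specialize (Hd x hb); simpl in Hd; apply Rabs_def2 in Hd; lra. }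
assert (Hi : forall i, (i <= S n)%nat -> forall x, 0 < x < d -> 0 < fund n c (S n - i) x).
{ induction i as [|i IH]; intros hi x hx.
  - rewrite Nat.sub_0_r; apply Htop; lra.
  - destruct (mvt_segment 0 x (fund n c (S n - S i)) (fund n c (S n - i))) as [t [ht E]].
    + lra.
    + intros t _; apply continuous_cont_in, fund_continuous, hn.
    + intros t _; replace (S n - i)%nat with (S (S n - S i)) by lia.
      now apply fund_derive.
    + rewrite fund_0, kappa_small in E by lia.
      specialize (IH ltac:(lia) t ltac:(lra)); nra. }
intros p x hp hx; replace p with (S n - (S n - p))%nat by lia; apply Hi; [lia|exact hx].
Qed.

(** * Linear systems and initial value problems *)

Fixpoint rsum (n : nat) (f : nat -> R) : R :=
  match n with O => 0 | S m => rsum m f + f m end.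

Lemma rsum_ext n f g : (forall i, (i < n)%nat -> f i = g i) -> rsum n f = rsum n g.
Proof.
induction n as [|n IH]; intros H; simpl; [reflexivity|].
rewrite (H n), IH; auto.
Qed.

Lemma rsum_le n f g : (forall i, (i < n)%nat -> f i <= g i) -> rsum n f <= rsum n g.
Proof.
induction n as [|n IH]; intros H; simpl; [lra|].
apply Rplus_le_compat; auto.
Qed.

Lemma rsum_plus n f g : rsum n (fun i => f i + g i) = rsum n f + rsum n g.
Proof. induction n as [|n IH]; simpl; [ring|rewrite IH; ring]. Qed.

Lemma rsum_scal n k f : rsum n (fun i => k * f i) = k * rsum n f.
Proof. induction n as [|n IH]; simpl; [ring|rewrite IH; ring]. Qed.

Lemma rsum_opp n f : rsum n (fun i => - f i) = - rsum n f.
Proof. induction n as [|n IH]; simpl; [ring|rewrite IH; ring]. Qed.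

Lemma rsum_zero n f : (forall i, (i < n)%nat -> f i = 0) -> rsum n f = 0.
Proof. intros H; induction n as [|n IH]; simpl; [ring|rewrite IH, H by auto; ring]. Qed.

Lemma rsum_single n f j :
  (j < n)%nat -> (forall i, (i < n)%nat -> i <> j -> f i = 0) -> rsum n f = f j.
Proof.
induction n as [|n IH]; intros hj H; simpl; [lia|].
destruct (Nat.eq_dec j n) as [->|hne].
- rewrite rsum_zero by (intros i hi; apply H; lia); ring.
- rewrite IH, (H n) by (try lia; intros; apply H; lia); ring.
Qed.

Lemma rsum_swap n m (f : nat -> nat -> R) :
  rsum n (fun i => rsum m (f i)) = rsum m (fun j => rsum n (fun i => f i j)).
Proof.
induction n as [|n IH]; simpl.
- now rewrite rsum_zero.
- now rewrite IH, rsum_plus.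
Qed.

Lemma rsum_abs n f : Rabs (rsum n f) <= rsum n (fun i => Rabs (f i)).
Proof.
induction n as [|n IH]; simpl; [rewrite Rabs_R0; lra|].
eapply Rle_trans; [apply Rabs_triang|lra].
Qed.

Lemma rsum_term n f j :
  (forall i, (i < n)%nat -> 0 <= f i) -> (j < n)%nat -> f j <= rsum n f.
Proof.
induction n as [|n IH]; intros H hj; simpl; [lia|].
assert (0 <= rsum n f).
{ rewrite <- (rsum_zero n (fun _ => 0)) by auto; apply rsum_le; auto. }
destruct (Nat.eq_dec j n) as [->|hne]; [lra|].
specialize (IH ltac:(auto) ltac:(lia)); specialize (H n ltac:(lia)); lra.
Qed.

Definition injective (n : nat) (A : nat -> nat -> R) : Prop :=
  forall x, (forall j, (j < n)%nat -> rsum n (fun i => x i * A i j) = 0) ->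
  forall i, (i < n)%nat -> x i = 0.

(** Gaussian elimination by induction on the dimension, with the pivot in the last row and column; a
    transposition of columns brings a nonzero entry there. *)
Lemma injective_solvable n : forall A, injective n A ->
  forall y, exists x, forall j, (j < n)%nat -> rsum n (fun i => x i * A i j) = y j.
Proof.
induction n as [|n IH]; [intros; exists y; lia|].
assert (Pivot : forall A, A n n <> 0 -> injective (S n) A ->
  forall y, exists x, forall j, (j < S n)%nat -> rsum (S n) (fun i => x i * A i j) = y j).
{ intros A hA HA y.
  (* The Schur complement of the pivot. *)
  set (A' := fun i j => A i j - A i n / A n n * A n j).
  assert (HE : forall (x : nat -> R) j,
    rsum n (fun i => x i * A' i j) =
    rsum n (fun i => x i * A i j) - rsum n (fun i => x i * A i n) / A n n * A n j).
  { intros x j; unfold A'.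
    replace (rsum n (fun i => x i * A i n) / A n n * A n j) with
      (A n j / A n n * rsum n (fun i => x i * A i n)) by (field; exact hA).
    rewrite <- rsum_scal.
    replace (rsum n (fun i => x i * A i j)) with
      (rsum n (fun i => x i * (A i j - A i n / A n n * A n j)) +
       rsum n (fun i => A n j / A n n * (x i * A i n))); [ring|].
    rewrite <- rsum_plus; apply rsum_ext; intros; field; exact hA. }
  pose (ext := fun (x : nat -> R) v i => if Nat.eqb i n then v else x i).
  assert (Hext : forall x v (a : nat -> R),
    rsum (S n) (fun i => ext x v i * a i) = rsum n (fun i => x i * a i) + v * a n).
  { intros x v a; simpl; unfold ext at 2; rewrite Nat.eqb_refl; f_equal.
    apply rsum_ext; intros i hi; unfold ext.
    now rewrite (proj2 (Nat.eqb_neq i n)) by lia. }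
  assert (HA' : injective n A').
  { intros x Hx i hi.
    specialize (HA (ext x (- rsum n (fun i => x i * A i n) / A n n))).
    replace (x i) with (ext x (- rsum n (fun i => x i * A i n) / A n n) i)
      by (unfold ext; now rewrite (proj2 (Nat.eqb_neq i n)) by lia).
    apply HA; [|lia]; intros j hj; rewrite Hext.
    destruct (Nat.eq_dec j n) as [->|hne]; [field; exact hA|].
    rewrite <- (Hx j), (HE x) by lia; field; exact hA. }
  destruct (IH A' HA' (fun j => y j - y n / A n n * A n j)) as [x Hx].
  exists (ext x ((y n - rsum n (fun i => x i * A i n)) / A n n)).
  intros j hj; rewrite Hext.
  destruct (Nat.eq_dec j n) as [->|hne]; [field; exact hA|].
  specialize (Hx j ltac:(lia)); rewrite (HE x) in Hx.
  replace (rsum n (fun i => x i * A i j)) with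
    (y j - y n / A n n * A n j + rsum n (fun i => x i * A i n) / A n n * A n j) by lra.
  field; exact hA. }
intros A HA y.
(* If the last row were zero, the last unit vector would contradict injectivity. *)
assert (Hj : exists j, (j < S n)%nat /\ A n j <> 0).
{ apply NNPP; intros Hno.
  assert (H1 : (fun i => if Nat.eqb i n then 1 else 0) n = 0); [|simpl in H1; rewrite Nat.eqb_refl in H1; lra].
  apply (HA (fun i => if Nat.eqb i n then 1 else 0)); [|lia].
  intros j hj; rewrite (rsum_single _ _ n); [|lia|].
  - rewrite Nat.eqb_refl, Rmult_1_l; apply NNPP; intros hne; apply Hno; eauto.
  - intros i _ hi; rewrite (proj2 (Nat.eqb_neq i n) hi); ring. }
destruct Hj as [j0 [hj0 hA]].
pose (tau := fun j => if Nat.eqb j j0 then n else if Nat.eqb j n then j0 else j).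
assert (Ht : forall j, tau (tau j) = j).
{ intros j; unfold tau; destruct (Nat.eqb_spec j j0), (Nat.eqb_spec j n);
  repeat match goal with |- context [Nat.eqb ?u ?v] => destruct (Nat.eqb_spec u v) end;
  congruence. }
assert (Hl : forall j, (j < S n)%nat -> (tau j < S n)%nat).
{ intros j hj; unfold tau; destruct (Nat.eqb j j0), (Nat.eqb j n); lia. }
destruct (Pivot (fun i j => A i (tau j))) with (y := fun j => y (tau j)) as [x Hx].
- unfold tau; destruct (Nat.eqb_spec n j0) as [->|]; [exact hA|].
  now rewrite Nat.eqb_refl.
- intros x Hx; apply HA; intros j hj; rewrite <- (Ht j); now apply Hx, Hl.
- exists x; intros j hj; rewrite <- (Ht j); now apply Hx, Hl.
Qed.

(** Row l of [B] solves the system for the l-th unit vector; the rows are collected one at a time by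
    induction on their number [m]. *)
Lemma injective_left_inverse n A :
  injective n A ->
  exists B : nat -> nat -> R, forall y j, (j < n)%nat ->
    rsum n (fun i => rsum n (fun l => y l * B l i) * A i j) = y j.
Proof.
intros HA.
assert (HB : forall m, exists B : nat -> nat -> R, forall l j, (l < m)%nat -> (j < n)%nat ->
  rsum n (fun i => B l i * A i j) = if Nat.eqb j l then 1 else 0).
{ induction m as [|m [B HB]]; [exists (fun _ _ => 0); lia|].
  destruct (injective_solvable n A HA (fun j => if Nat.eqb j m then 1 else 0)) as [x Hx].
  exists (fun l => if Nat.eqb l m then x else B l); intros l j hl hj.
  destruct (Nat.eqb_spec l m) as [->|]; [now apply Hx|apply HB; lia]. }
destruct (HB n) as [B HBn]; exists B; intros y j hj.
rewrite (rsum_ext _ _ (fun i => rsum n (fun l => y l * (B l i * A i j)))).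
- rewrite rsum_swap, (rsum_single _ _ j hj).
  + rewrite rsum_scal, HBn, Nat.eqb_refl by assumption; ring.
  + intros l hl hne; rewrite rsum_scal, HBn by assumption.
    rewrite (proj2 (Nat.eqb_neq j l)) by lia; ring.
- intros i _; rewrite Rmult_comm, <- rsum_scal; apply rsum_ext; intros; ring.
Qed.

Lemma cont_in_plus D f g t :
  cont_in D f t -> cont_in D g t -> cont_in D (fun x => f x + g x) t.
Proof.
intros Hf Hg; eapply filterlim_comp_2; [exact Hf|exact Hg|].
apply (filterlim_plus (K := R_AbsRing) (V := R_NormedModule)).
Qed.

Lemma cont_in_mult D f g t :
  cont_in D f t -> cont_in D g t -> cont_in D (fun x => f x * g x) t.
Proof.
intros Hf Hg; eapply filterlim_comp_2; [exact Hf|exact Hg|].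
apply (filterlim_mult (K := R_AbsRing)).
Qed.

Lemma cont_in_const D k t : cont_in D (fun _ => k) t.
Proof. apply filterlim_const. Qed.

Lemma cont_in_rsum D n (f : nat -> R -> R) t :
  (forall i, (i < n)%nat -> cont_in D (f i) t) ->
  cont_in D (fun x => rsum n (fun i => f i x)) t.
Proof.
induction n as [|n IH]; intros H; simpl; [apply cont_in_const|].
apply cont_in_plus; auto.
Qed.

Lemma is_derive_rsum n (f f' : nat -> R -> R) t :
  (forall i, (i < n)%nat -> is_derive (f i) t (f' i t)) ->
  is_derive (fun x => rsum n (fun i => f i x)) t (rsum n (fun i => f' i t)).
Proof.
induction n as [|n IH]; intros H; simpl.
- apply (is_derive_const (K := R_AbsRing) (V := R_NormedModule)).
- apply (is_derive_plus (K := R_AbsRing) (V := R_NormedModule)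
    (fun x => rsum n (fun i => f i x)) (f n)); auto.
Qed.

(* Gronwall's inequality for the energy [sum_i U_i^2]. *)
Lemma initial_value_estimate n c a b :
  (1 <= n)%nat -> a < b ->
  exists C, 0 <= C /\ forall (U : nat -> R -> R) B, 0 <= B ->
    (forall i t, (i < n)%nat -> segment a b t ->
       is_derive_on (segment a b) (U i) t (U (S i) t)) ->
    (forall i, (i < n)%nat -> U i a = 0) ->
    (forall t, segment a b t -> Rabs (U n t - c * U O t) <= B) ->
    forall i t, (i < n)%nat -> segment a b t -> Rabs (U i t) <= C * B.
Proof.
intros hn hab.
(* With 2 u v <= u^2 + v^2 the derivative of E is at most E plus the shifted sum of squares, which
   is E - U_0^2 + U_n^2. Since U_n^2 <= 2 c^2 U_0^2 + 2 B^2, this gives E' <= A E + 2 B^2. *)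
set (A := 2 + 2 * c * c).
assert (hA : 0 <= A) by (unfold A; nra).
set (D := 2 * (b - a) * exp (A * (b - a))).
assert (hD : 0 <= D) by
  (unfold D; pose proof (exp_pos (A * (b - a))); apply Rmult_le_pos; lra).
(* From E <= D B^2 one gets |U_i| <= (1 + D) B without a square root, as D <= (1 + D)^2. *)
exists (1 + D); split; [lra|].
intros U B hB HU Ha HB i t hi ht.
set (E := fun t => rsum n (fun i => U i t * U i t)).
set (E' := fun t => rsum n (fun i => U (S i) t * U i t + U i t * U (S i) t)).
assert (hE : forall t, 0 <= E t).
{ intros x; unfold E; rewrite <- (rsum_zero n (fun _ => 0)) by auto.
  apply rsum_le; intros; nra. }
assert (HE' : forall t, segment a b t -> E' t <= A * E t + 2 * B * B).
{ intros x hx.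
  assert (H1 : E' x <= E x + rsum n (fun i => U (S i) x * U (S i) x)).
  { unfold E', E; rewrite <- rsum_plus; apply rsum_le; intros j hj.
    pose proof (Rle_0_sqr (U j x - U (S j) x)); unfold Rsqr in *; nra. }
  assert (H2 : forall m, rsum m (fun i => U (S i) x * U (S i) x) =
    rsum m (fun i => U i x * U i x) - U O x * U O x + U m x * U m x).
  { induction m as [|m IH]; simpl; [ring|rewrite IH; ring]. }
  rewrite H2 in H1; fold (E x) in H1.
  assert (H3 : U O x * U O x <= E x).
  { apply (rsum_term n (fun i => U i x * U i x)); [intros; nra|lia]. }
  assert (H4 : U n x * U n x <= 2 * c * c * (U O x * U O x) + 2 * B * B).
  { specialize (HB x hx); apply Rabs_le_between in HB.
    set (w := U n x - c * U O x) in *.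
    replace (U n x) with (w + c * U O x) by (unfold w; ring).
    assert (w * w <= B * B) by nra.
    pose proof (Rle_0_sqr (w - c * U O x)); unfold Rsqr in *; nra. }
  pose proof (Rle_0_sqr (U O x)); unfold A; pose proof (Rle_0_sqr c);
  unfold Rsqr in *; nra. }
(* The integrating factor exp(-A (t - a)) makes this function nonincreasing. *)
set (F := fun t => exp (- A * (t - a)) * E t + - (2 * B * B) * (t - a)).
assert (HF : F t <= F a).
{ destruct (Req_dec a t) as [<-|hne]; [lra|].
  destruct (mvt_segment a t F (fun t => ((- A) * exp (- A * (t - a)) * E t +
      exp (- A * (t - a)) * E' t) + - (2 * B * B))) as [x [hx Hx]].
  - destruct ht; lra.
  - intros x hx; apply cont_in_subset with (segment a b);
      [intros z [h1 h2]; destruct ht; split; lra|].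
    assert (hx' : segment a b x) by (destruct hx, ht; split; lra).
    apply cont_in_plus; apply cont_in_mult.
    + apply continuous_cont_in, (ex_derive_continuous (K := R_AbsRing) (V := R_NormedModule)).
      auto_derive; auto.
    + apply cont_in_rsum; intros j hj; apply cont_in_mult;
        apply is_derive_on_cont with (U (S j) x); auto.
    + apply cont_in_const.
    + apply continuous_cont_in, (ex_derive_continuous (K := R_AbsRing) (V := R_NormedModule)).
      auto_derive; auto.
  - intros x hx.
    assert (HEd : is_derive E x (E' x)).
    { apply (is_derive_rsum n (fun i x => U i x * U i x)
        (fun i x => U (S i) x * U i x + U i x * U (S i) x)).
      intros j hj.
      assert (is_derive (U j) x (U (S j) x)).
      { apply is_derive_on_interior with a b; [destruct ht; lra|].
        apply HU; [exact hj|destruct ht; split; lra]. }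
      apply (is_derive_mult (U j) (U j)); auto using Rmult_comm. }
    unfold F.
    apply (is_derive_plus (K := R_AbsRing) (V := R_NormedModule)
      (fun t => exp (- A * (t - a)) * E t) (fun t => - (2 * B * B) * (t - a))).
    + apply (is_derive_mult (fun t => exp (- A * (t - a))) E);
        [|exact HEd|auto using Rmult_comm].
      auto_derive; [auto|unfold Rminus; ring].
    + auto_derive; [auto|ring].
  - assert (hx' : segment a b x) by (destruct ht; split; lra).
    specialize (HE' x hx'); specialize (hE x).
    assert (he : exp (- A * (x - a)) <= 1).
    { rewrite <- exp_0; destruct (Req_dec (- A * (x - a)) 0) as [->|]; [lra|].
      left; apply exp_increasing; nra. }
    pose proof (exp_pos (- A * (x - a))).
    assert (F t - F a <= 0); [rewrite Hx|lra].
    assert (hBB : 0 <= 2 * B * B) by nra.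
    assert (exp (- A * (x - a)) * (E' x - A * E x) <= 2 * B * B).
    { eapply Rle_trans; [apply Rmult_le_compat_l with (r2 := 2 * B * B); lra|nra]. }
    assert (0 < t - a) by lra.
    nra. }
assert (HFa : F a = 0).
{ unfold F, E; rewrite rsum_zero; [ring|]; intros j hj; rewrite Ha by exact hj; ring. }
rewrite HFa in HF; unfold F in HF.
assert (Ht : E t <= D * (B * B)).
{ assert (hexp : exp (- A * (t - a)) * exp (A * (t - a)) = 1).
  { rewrite <- exp_plus; replace (- A * (t - a) + A * (t - a)) with 0 by ring; apply exp_0. }
  pose proof (exp_pos (A * (t - a))).
  assert (H1 : E t <= 2 * B * B * (t - a) * exp (A * (t - a))).
  { apply Rmult_le_compat_r with (r := exp (A * (t - a))) in HF; [|lra].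
    rewrite Rmult_plus_distr_r, (Rmult_assoc _ (E t)), (Rmult_comm (E t)), <- Rmult_assoc, hexp in HF.
    lra. }
  assert (H2 : exp (A * (t - a)) <= exp (A * (b - a))).
  { destruct ht; destruct (Req_dec (A * (t - a)) (A * (b - a))) as [->|]; [lra|].
    left; apply exp_increasing; nra. }
  eapply Rle_trans; [exact H1|]; unfold D; destruct ht.
  replace (2 * (b - a) * exp (A * (b - a)) * (B * B)) with
    (2 * B * B * ((b - a) * exp (A * (b - a)))) by ring.
  rewrite Rmult_assoc; apply Rmult_le_compat_l; [nra|].
  apply Rmult_le_compat; lra. }
assert (Hi : U i t * U i t <= E t) by
  (apply (rsum_term n (fun i => U i t * U i t)); [intros; nra|lia]).
apply Rsqr_incr_0_var; [|nra].
rewrite <- Rsqr_abs; unfold Rsqr.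
assert (0 <= B * B) by nra.
assert (0 <= D * D) by nra. nra.
Qed.

(** * Boundary value problems *)

Lemma zero_derivatives m a b (U : nat -> R -> R) :
  a < b ->
  (forall i t, (i < m)%nat -> segment a b t ->
     is_derive_on (segment a b) (U i) t (U (S i) t)) ->
  (forall t, segment a b t -> U O t = 0) ->
  forall i t, (i <= m)%nat -> segment a b t -> U i t = 0.
Proof.
intros hab HU H0 i; induction i as [|i IH]; intros t hi ht; [now apply H0|].
apply (is_derive_on_unique a b (U i) (fun _ => 0) t _ _ hab ht).
- intros x hx; apply IH; [lia|exact hx].
- apply HU; [lia|exact ht].
- apply is_derive_derive_on; [exact ht|].
  apply (is_derive_const (K := R_AbsRing) (V := R_NormedModule)).
Qed.

(** Numbers the boundary conditions as pairs of an order and an endpoint, so that the boundary value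
    problem becomes a square linear system. The default of [nth] is out of reach for j < |A| +
    |B|. *)
Definition condition (a b : R) (A B : list nat) (j : nat) : nat * R :=
  nth j (map (fun i => (i, a)) A ++ map (fun i => (i, b)) B) (O, a).

Lemma condition_cases a b A B j :
  (j < length A + length B)%nat ->
  (In (fst (condition a b A B j)) A /\ snd (condition a b A B j) = a) \/
  (In (fst (condition a b A B j)) B /\ snd (condition a b A B j) = b).
Proof.
intros hj.
assert (H : In (condition a b A B j) (map (fun i => (i, a)) A ++ map (fun i => (i, b)) B)).
{ apply nth_In; rewrite length_app, !length_map; exact hj. }
apply in_app_or in H; destruct H as [H|H]; apply in_map_iff in H;
  destruct H as [i [<- Hi]]; simpl; auto.
Qed.

Lemma boundary_conditions a b A B U :
  boundary a b A B U <->
  forall j, (j < length A + length B)%nat ->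
    U (fst (condition a b A B j)) (snd (condition a b A B j)) = 0.
Proof.
split.
- intros [Ha Hb] j hj.
  destruct (condition_cases a b A B j hj) as [[h ->]|[h ->]]; auto.
- intros H.
  assert (H' : forall p, In p (map (fun i => (i, a)) A ++ map (fun i => (i, b)) B) ->
    U (fst p) (snd p) = 0).
  { intros p Hp; apply (In_nth _ _ (O, a)) in Hp; destruct Hp as [j [hj <-]].
    rewrite length_app, !length_map in hj; exact (H j hj). }
  split; intros i hi.
  + apply (H' (i, a)), in_or_app; left; apply in_map_iff; eauto.
  + apply (H' (i, b)), in_or_app; right; apply in_map_iff; eauto.
Qed.

(** The i-th derivative of the solution of u^(n) = c u whose initial data at a are the l-th unit
    vector: K^(n+1-l), because K^(n+1)(0) = 1 is the only nonzero derivative of K at 0 up to order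
    2n. *)
Definition basis (n : nat) (c a : R) (l i : nat) (t : R) : R :=
  fund n c (n + 1 - l + i) (t - a).

Definition comb (n : nat) (c a : R) (x : nat -> R) (i : nat) (t : R) : R :=
  rsum n (fun l => x l * basis n c a l i t).

Lemma fund_shift_derive n c p s t :
  (1 <= n)%nat -> is_derive (fun t => fund n c p (t - s)) t (fund n c (S p) (t - s)).
Proof.
intros hn; evar_last.
- apply (is_derive_comp (K := R_AbsRing) (V := R_NormedModule) (fund n c p) (fun t => t - s)).
  + now apply fund_derive.
  + instantiate (1 := 1); auto_derive; auto; ring.
- unfold scal; simpl; unfold mult; simpl; ring.
Qed.

Lemma comb_derive n c a x i t :
  (1 <= n)%nat -> is_derive (comb n c a x i) t (comb n c a x (S i) t).
Proof.
intros hn; apply (is_derive_rsum n (fun l t => x l * basis n c a l i t)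
  (fun l t => x l * basis n c a l (S i) t)).
intros l hl; apply is_derive_scal; unfold basis.
replace (n + 1 - l + S i)%nat with (S (n + 1 - l + i)) by lia.
now apply fund_shift_derive.
Qed.

Lemma comb_ode n c a x t : (1 <= n)%nat -> comb n c a x n t = c * comb n c a x O t.
Proof.
intros hn; unfold comb; rewrite <- rsum_scal; apply rsum_ext; intros l hl; unfold basis.
replace (n + 1 - l + n)%nat with (n + (n + 1 - l))%nat by lia.
rewrite fund_shift by lia; rewrite Nat.add_0_r; ring.
Qed.

Lemma comb_initial n c a x i : (i < n)%nat -> comb n c a x i a = x i.
Proof.
intros hi; unfold comb, basis; rewrite Rminus_diag, (rsum_single _ _ i hi).
- replace (n + 1 - i + i)%nat with (S n) by lia; rewrite fund_0, kappa_Sn by lia; ring.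
- intros l hl hne; rewrite fund_0.
  destruct (le_lt_dec (n + 1 - l + i) n).
  + rewrite kappa_small by lia; ring.
  + rewrite kappa_mid by lia; ring.
Qed.

Lemma comb_minus n c a x y i t :
  comb n c a (fun l => x l - y l) i t = comb n c a x i t - comb n c a y i t.
Proof.
unfold comb.
replace (rsum n (fun l => x l * basis n c a l i t)) with
  (rsum n (fun l => (x l - y l) * basis n c a l i t + y l * basis n c a l i t));
  [rewrite rsum_plus; ring|apply rsum_ext; intros; ring].
Qed.

(** [T] inverts the matrix of boundary values of [basis]: it converts prescribed boundary values [y]
    into initial data [x] at a. *)
Definition bvp_inverse (n : nat) (c a b : R) (A B : list nat) (T : nat -> nat -> R) :
    Prop :=
  forall x y, (forall j, (j < n)%nat ->
    comb n c a x (fst (condition a b A B j)) (snd (condition a b A B j)) = y j) <->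
  (forall l, (l < n)%nat -> x l = rsum n (fun j => y j * T j l)).

Lemma comb_ext n c a x y i t :
  (forall l, (l < n)%nat -> x l = y l) -> comb n c a x i t = comb n c a y i t.
Proof. intros H; apply rsum_ext; intros l hl; now rewrite H. Qed.

(** A nonzero vector in the kernel of the boundary matrix is the initial data of an eigenfunction.
    In the convention u^(n) + lambda u = 0 its eigenvalue is -c. *)
Lemma bvp_inverse_exists n c a b A B :
  (1 <= n)%nat -> a < b -> (length A + length B = n)%nat ->
  (forall i, In i A -> (i < n)%nat) -> (forall i, In i B -> (i < n)%nat) ->
  ~ eigenvalue n a b A B (- c) ->
  exists T, bvp_inverse n c a b A B T.
Proof.
intros hn hab hAB HA HB Hne.
set (cd := condition a b A B).
assert (Hinj : injective n (fun l j => basis n c a l (fst (cd j)) (snd (cd j)))).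
{ intros x Hx i hi; apply NNPP; intros hxi; apply Hne.
  exists (comb n c a x); split; [split; [split|]|split].
  - intros l t _ ht; apply is_derive_derive_on, comb_derive; auto.
  - apply continuous_on_forall; intros t _.
    apply (ex_derive_continuous (K := R_AbsRing) (V := R_NormedModule)).
    eexists; now apply comb_derive.
  - apply boundary_conditions; rewrite hAB; exact Hx.
  - apply NNPP; intros Hz; apply hxi.
    rewrite <- (comb_initial n c a x i hi).
    apply (zero_derivatives n a b (comb n c a x) hab); [| |lia|split; lra].
    + intros l t _ ht; apply is_derive_derive_on, comb_derive; auto.
    + intros t ht; apply NNPP; intros hne; apply Hz; eauto.
  - intros t _; rewrite comb_ode by exact hn; ring. }
destruct (injective_left_inverse n _ Hinj) as [T HT].
exists T; intros x y; split.
- intros Hx l hl; apply Rminus_diag_uniq; revert l hl.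
  apply Hinj; intros j hj.
  specialize (Hx j hj); specialize (HT y j hj).
  change (comb n c a (fun l => x l - rsum n (fun j => y j * T j l))
    (fst (cd j)) (snd (cd j)) = 0).
  rewrite comb_minus; unfold cd at 1 2; rewrite Hx; unfold comb; rewrite HT; ring.
- intros Hx j hj; rewrite (comb_ext n c a x _ _ _ Hx); now apply HT.
Qed.

Lemma finite_bound (n : nat) (P : nat -> R -> Prop) :
  (forall i K K', P i K -> K <= K' -> P i K') ->
  (forall i, (i < n)%nat -> exists K, P i K) ->
  exists K, forall i, (i < n)%nat -> P i K.
Proof.
intros Hm; induction n as [|n IH]; intros H; [exists 0; lia|].
destruct IH as [K HK]; [auto|]; destruct (H n) as [K' HK']; [lia|].
exists (Rmax K K'); intros i hi; destruct (Nat.eq_dec i n) as [->|].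
- apply Hm with K'; [exact HK'|apply Rmax_r].
- apply Hm with K; [apply HK; lia|apply Rmax_l].
Qed.

(** Subtracting the homogeneous solution with the same initial data leaves [V] with zero initial
    data, which the initial value estimate bounds. The boundary values of [V] then bound the
    subtracted part through [T]. *)
Lemma bvp_estimate n c a b A B T :
  (1 <= n)%nat -> a < b -> (length A + length B = n)%nat ->
  (forall i, In i A -> (i < n)%nat) -> (forall i, In i B -> (i < n)%nat) ->
  bvp_inverse n c a b A B T ->
  exists C, 0 <= C /\ forall U r, 0 <= r -> space_X n a b A B U ->
    (forall t, segment a b t -> Rabs (U n t - c * U O t) <= r) ->
    forall t, segment a b t -> Rabs (U O t) <= C * r.
Proof.
intros hn hab hAB HA HB HT.
destruct (initial_value_estimate n c a b hn hab) as [C0 [hC0 HC0]].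
destruct (finite_bound n (fun l K => 0 <= K /\ forall t, segment a b t ->
  Rabs (basis n c a l O t) <= K)) as [K HK].
{ intros l K K' [h H] hK; split; [lra|]; intros t ht; specialize (H t ht); lra. }
{ intros l hl; apply cont_in_bounded; [lra|]; intros t _.
  apply continuous_cont_in, (ex_derive_continuous (K := R_AbsRing) (V := R_NormedModule)).
  eexists; now apply fund_shift_derive. }
set (N := rsum n (fun l => rsum n (fun j => Rabs (T j l)) * K)).
assert (HKp : 0 <= K) by (apply (HK O); lia).
assert (hTl : forall l, 0 <= rsum n (fun j => Rabs (T j l))).
{ intros l; rewrite <- (rsum_zero n (fun _ => 0)) by auto.
  apply rsum_le; intros; apply Rabs_pos. }
assert (hN : 0 <= N).
{ unfold N; rewrite <- (rsum_zero n (fun _ => 0)) by auto; apply rsum_le; intros l hl.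
  apply Rmult_le_pos; auto. }
exists (C0 + C0 * N); split; [pose proof (Rmult_le_pos _ _ hC0 hN); lra|].
intros U r hr [[HU Hc] Hbd] Hr t ht.
set (x := fun l => U l a).
set (V := fun i t => U i t + (-1) * comb n c a x i t).
assert (HV : forall i t, (i < n)%nat -> segment a b t -> Rabs (V i t) <= C0 * r).
{ apply (HC0 V r hr).
  - intros i u hi hu; unfold V; apply is_derive_on_plus; [now apply HU|].
    apply is_derive_on_scal, is_derive_derive_on, comb_derive; auto.
  - intros i hi; unfold V; rewrite comb_initial by exact hi; unfold x; ring.
  - intros u hu; unfold V; rewrite comb_ode by exact hn.
    replace (_ - _) with (U n u - c * U O u) by ring; auto. }
(* As U satisfies the boundary conditions, these are the boundary values of the homogeneous part. *)
set (y := fun j => - V (fst (condition a b A B j)) (snd (condition a b A B j))).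
assert (Hcd : forall j, (j < n)%nat -> (fst (condition a b A B j) < n)%nat /\
  segment a b (snd (condition a b A B j))).
{ intros j hj; destruct (condition_cases a b A B j ltac:(lia)) as [[h ->]|[h ->]];
    split; auto; split; lra. }
assert (Hx : forall l, (l < n)%nat -> x l = rsum n (fun j => y j * T j l)).
{ apply (proj1 (HT x y)); intros j hj; unfold y, V.
  rewrite (proj1 (boundary_conditions a b A B U) Hbd j) by lia; ring. }
assert (Hx' : forall l, (l < n)%nat -> Rabs (x l) <= C0 * r * rsum n (fun j => Rabs (T j l))).
{ intros l hl; rewrite (Hx l hl); eapply Rle_trans; [apply rsum_abs|].
  rewrite <- rsum_scal; apply rsum_le; intros j hj; rewrite Rabs_mult.
  apply Rmult_le_compat_r; [apply Rabs_pos|]; unfold y; rewrite Rabs_Ropp.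
  destruct (Hcd j hj); now apply HV. }
replace (U O t) with (V O t + comb n c a x O t) by (unfold V; ring).
eapply Rle_trans; [apply Rabs_triang|].
rewrite Rmult_plus_distr_r; apply Rplus_le_compat; [apply HV; [lia|exact ht]|].
unfold comb; eapply Rle_trans; [apply rsum_abs|].
replace (C0 * N * r) with (C0 * r * N) by ring; unfold N; rewrite <- rsum_scal.
apply rsum_le; intros l hl; rewrite Rabs_mult, <- Rmult_assoc.
apply Rmult_le_compat; try apply Rabs_pos; auto; now apply (HK l hl).
Qed.

(** * Explicit solutions *)

(** Continuous for p <= n, since these K^(p) vanish at 0. For p = n + 1 it jumps by 1 at 0, which
    becomes the jump of the Green's function; the value 0 taken there is a convention. *)
Definition step_fund (n : nat) (c : R) (p : nat) (x : R) : R :=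
  if Rlt_dec 0 x then fund n c p x else 0.

Lemma step_fund_pos n c p x : 0 < x -> step_fund n c p x = fund n c p x.
Proof. intros h; unfold step_fund; destruct Rlt_dec; [reflexivity|lra]. Qed.

Lemma step_fund_neg n c p x : x <= 0 -> step_fund n c p x = 0.
Proof. intros h; unfold step_fund; destruct Rlt_dec; [lra|reflexivity]. Qed.

Lemma step_fund_nonneg n c p x :
  (p <= n)%nat -> 0 <= x -> step_fund n c p x = fund n c p x.
Proof.
intros hp [hx|<-]; [now apply step_fund_pos|].
rewrite step_fund_neg by lra; now rewrite fund_0, kappa_small.
Qed.

Lemma is_derive_interior_dist f t l :
  (forall e, 0 < e -> exists d, 0 < d /\
    forall y, Rabs (y - t) < d -> Rabs (f y - f t - (y - t) * l) <= e * Rabs (y - t)) ->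
  is_derive f t l.
Proof.
intros H; apply is_derive_on_interior with (t - 1) (t + 1); [lra|].
apply is_derive_on_eps; [split; lra|].
intros e he; destruct (H e he) as [d [hd Hd]]; exists d; split; auto.
Qed.

Lemma step_fund_derive n c p x :
  (1 <= n)%nat -> x <> 0 \/ (p + 1 <= n)%nat ->
  is_derive (step_fund n c p) x (step_fund n c (S p) x).
Proof.
intros hn H.
destruct (total_order_T x 0) as [[h|h]|h].
- rewrite step_fund_neg by lra.
  apply is_derive_ext_loc with (fun _ => 0).
  + apply (locally_interval _ x m_infty (Finite 0)); simpl; auto.
    intros y _ hy; rewrite step_fund_neg; [reflexivity|lra].
  + apply (is_derive_const (K := R_AbsRing) (V := R_NormedModule)).
- subst x; destruct H as [H|H]; [lra|].
  rewrite step_fund_neg by lra.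
  apply is_derive_interior_dist; intros e he.
  assert (Hd : is_derive_on (fun _ => True) (fund n c p) 0 0).
  { apply is_derive_derive_on; [exact I|].
    evar_last; [apply fund_derive, hn|rewrite fund_0; apply kappa_small; lia]. }
  rewrite (is_derive_on_eps (fun _ => True) (fund n c p) 0 0 I) in Hd.
  destruct (Hd e he) as [d [hd Hd']]; exists d; split; [exact hd|].
  intros y hy; specialize (Hd' y I hy).
  rewrite (step_fund_neg _ _ _ 0) by lra.
  destruct (Rle_lt_dec y 0).
  + rewrite step_fund_neg by assumption.
    replace (0 - 0 - (y - 0) * 0) with 0 by ring; rewrite Rabs_R0.
    apply Rmult_le_pos; [lra|apply Rabs_pos].
  + rewrite step_fund_pos by assumption.
    rewrite fund_0, kappa_small in Hd' by lia; exact Hd'.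
- rewrite step_fund_pos by lra.
  apply is_derive_ext_loc with (fund n c p); [|now apply fund_derive].
  apply (locally_interval _ x (Finite 0) p_infty); simpl; auto.
  intros y hy _; now rewrite step_fund_pos.
Qed.

Lemma step_fund_continuous n c p x :
  (1 <= n)%nat -> x <> 0 \/ (p <= n)%nat -> continuous (step_fund n c p) x.
Proof.
intros hn H; destruct (Req_dec x 0) as [->|hx].
- destruct H as [H|H]; [lra|].
  apply continuity_pt_filterlim, continuity_pt_locally; intros e.
  pose proof (fund_continuous n c p 0 hn) as Hc.
  apply continuity_pt_filterlim in Hc.
  destruct (proj1 (continuity_pt_locally _ _) Hc e) as [d Hd]; exists d; intros y hy.
  specialize (Hd y hy); rewrite fund_0, kappa_small in Hd by exact H.
  rewrite (step_fund_neg _ _ _ 0) by lra.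
  destruct (Rle_lt_dec y 0).
  + rewrite step_fund_neg, Rminus_0_r, Rabs_R0 by assumption; apply cond_pos.
  + now rewrite step_fund_pos by assumption.
- apply (ex_derive_continuous (K := R_AbsRing) (V := R_NormedModule)).
  eexists; apply step_fund_derive; auto.
Qed.

Lemma step_fund_derive_left n c p s t :
  (1 <= n)%nat -> t <> s \/ (p + 1 <= n)%nat ->
  is_derive (fun t => step_fund n c p (t - s)) t (step_fund n c (S p) (t - s)).
Proof.
intros hn H; evar_last.
- apply (is_derive_comp (K := R_AbsRing) (V := R_NormedModule)
    (step_fund n c p) (fun t => t - s)).
  + apply step_fund_derive; [exact hn|]; destruct H; [left; lra|now right].
  + instantiate (1 := 1); auto_derive; auto; ring.
- unfold scal; simpl; unfold mult; simpl; ring.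
Qed.

Lemma step_fund_derive_right n c p s t :
  (1 <= n)%nat -> t <> s \/ (p + 1 <= n)%nat ->
  is_derive (fun s => step_fund n c p (t - s)) s (- step_fund n c (S p) (t - s)).
Proof.
intros hn H; evar_last.
- apply (is_derive_comp (K := R_AbsRing) (V := R_NormedModule)
    (step_fund n c p) (fun s => t - s)).
  + apply step_fund_derive; [exact hn|]; destruct H; [left; lra|now right].
  + instantiate (1 := -1); auto_derive; auto; ring.
- unfold scal; simpl; unfold mult; simpl; ring.
Qed.

(* [response 0], [response 1] and [response 2] solve the boundary value problem
   with right-hand side [max(t - s, 0)], the step at [s] and the unit mass at
   [s]; the last one is the Green's function. *)
Definition correction (n : nat) (c a b : R) (A B : list nat) (T : nat -> nat -> R)
    (p : nat) (s : R) (l : nat) : R :=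
  rsum n (fun j => step_fund n c (p + fst (condition a b A B j))
                     (snd (condition a b A B j) - s) * T j l).

Definition response (n : nat) (c a b : R) (A B : list nat) (T : nat -> nat -> R)
    (p i : nat) (s t : R) : R :=
  step_fund n c (p + i) (t - s) - comb n c a (correction n c a b A B T p s) i t.

Lemma response_derive n c a b A B T p i s t :
  (1 <= n)%nat -> t <> s \/ (p + i + 1 <= n)%nat ->
  is_derive (response n c a b A B T p i s) t (response n c a b A B T p (S i) s t).
Proof.
intros hn H; unfold response.
apply (is_derive_minus (K := R_AbsRing) (V := R_NormedModule)
  (fun t => step_fund n c (p + i) (t - s)) (comb n c a (correction n c a b A B T p s) i)).
- replace (p + S i)%nat with (S (p + i)) by lia; now apply step_fund_derive_left.
- now apply comb_derive.
Qed.

(** Moving the source links the three responses: the derivative in s of the ramp is minus the step,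
    that of the step minus the unit mass. The hypotheses keep t and the endpoints away from s
    wherever the cut-off kernel is not differentiable. *)
Lemma response_derive_source n c a b A B T p i s t :
  (1 <= n)%nat -> t <> s \/ (p + i + 1 <= n)%nat ->
  (forall j, (j < n)%nat -> snd (condition a b A B j) <> s \/
     (p + fst (condition a b A B j) + 1 <= n)%nat) ->
  is_derive (fun s => response n c a b A B T p i s t) s
    (- response n c a b A B T (S p) i s t).
Proof.
intros hn H Hj; unfold response; evar_last.
- apply (is_derive_minus (K := R_AbsRing) (V := R_NormedModule)
    (fun s => step_fund n c (p + i) (t - s))
    (fun s => comb n c a (correction n c a b A B T p s) i t)).
  + now apply step_fund_derive_right.
  + apply (is_derive_rsum n
      (fun l s => correction n c a b A B T p s l * basis n c a l i t)
      (fun l s => - correction n c a b A B T (S p) s l * basis n c a l i t)).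
    intros l hl; evar_last.
    * apply (is_derive_scal_l (K := R_AbsRing) (V := R_NormedModule)
        (fun s => correction n c a b A B T p s l)).
      apply (is_derive_rsum n
        (fun j s => step_fund n c (p + fst (condition a b A B j))
                     (snd (condition a b A B j) - s) * T j l)
        (fun j s => - step_fund n c (S p + fst (condition a b A B j))
                     (snd (condition a b A B j) - s) * T j l)).
      intros j hj.
      apply (is_derive_scal_l (K := R_AbsRing) (V := R_NormedModule)
        (fun s => step_fund n c (p + fst (condition a b A B j))
                     (snd (condition a b A B j) - s))).
      apply step_fund_derive_right; auto.
    * unfold scal; simpl; unfold mult; simpl; f_equal.
      unfold correction; rewrite <- rsum_opp; apply rsum_ext; intros; simpl; ring.
- unfold minus, plus, opp; simpl; unfold comb.
  rewrite (rsum_ext n (fun l => - correction n c a b A B T (S p) s l * basis n c a l i t)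
    (fun l => - (correction n c a b A B T (S p) s l * basis n c a l i t))) by (intros; ring).
  rewrite rsum_opp; ring.
Qed.

Lemma response_boundary n c a b A B T p j s :
  (length A + length B = n)%nat -> bvp_inverse n c a b A B T -> (j < n)%nat ->
  response n c a b A B T p (fst (condition a b A B j)) s (snd (condition a b A B j)) = 0.
Proof.
intros hAB HT hj; unfold response.
rewrite (proj2 (HT (correction n c a b A B T p s)
  (fun j => step_fund n c (p + fst (condition a b A B j)) (snd (condition a b A B j) - s)))
  (fun l hl => eq_refl)); [ring|exact hj].
Qed.

Lemma response0_ode n c a b A B T s t :
  (1 <= n)%nat ->
  response n c a b A B T 0 n s t = c * response n c a b A B T 0 0 s t + Rmax 0 (t - s).
Proof.
intros hn; unfold response; rewrite comb_ode by exact hn.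
destruct (Rle_lt_dec (t - s) 0).
- rewrite !step_fund_neg, Rmax_left by lra; ring.
- rewrite !step_fund_pos, Rmax_right by lra; simpl Nat.add; rewrite fund_shift0 by exact hn; ring.
Qed.

Lemma response2_ode n c a b A B T s t :
  (1 <= n)%nat ->
  response n c a b A B T 2 n s t = c * response n c a b A B T 2 0 s t.
Proof.
intros hn; unfold response; rewrite comb_ode by exact hn.
destruct (Rle_lt_dec (t - s) 0).
- rewrite !step_fund_neg by lra; ring.
- rewrite !step_fund_pos by lra; replace (2 + n)%nat with (n + 2)%nat by lia.
  rewrite fund_shift by lia; simpl Nat.add; ring.
Qed.

Lemma response0_space n c a b A B T s :
  (1 <= n)%nat -> (length A + length B = n)%nat -> bvp_inverse n c a b A B T ->
  space_X n a b A B (fun i => response n c a b A B T 0 i s).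
Proof.
intros hn hAB HT; split; [split|].
- intros i t hi ht; apply is_derive_derive_on; [exact ht|].
  apply response_derive; [exact hn|right; lia].
- apply continuous_on_forall; intros t _.
  apply (continuous_minus (K := R_AbsRing) (V := R_NormedModule)
    (fun t => step_fund n c n (t - s)) (comb n c a (correction n c a b A B T 0 s) n)).
  + apply (continuous_comp (fun t => t - s) (step_fund n c n)).
    * apply (ex_derive_continuous (K := R_AbsRing) (V := R_NormedModule)); auto_derive; auto.
    * apply step_fund_continuous; auto.
  + apply (ex_derive_continuous (K := R_AbsRing) (V := R_NormedModule)).
    eexists; now apply comb_derive.
- apply boundary_conditions; rewrite hAB; intros j hj; now apply response_boundary.
Qed.

(** The solution with constant load 1, that is the step response with source a. It is built from
    [fund] and not from [step_fund], so that the n-th derivative is also right at t = a. *)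
Definition unit_solution (n : nat) (c a b : R) (A B : list nat) (T : nat -> nat -> R)
    (i : nat) (t : R) : R :=
  fund n c (1 + i) (t - a) - comb n c a (correction n c a b A B T 1 a) i t.

Lemma unit_solution_response n c a b A B T i t :
  (i < n)%nat -> a <= t ->
  unit_solution n c a b A B T i t = response n c a b A B T 1 i a t.
Proof.
intros hi ht; unfold unit_solution, response.
rewrite step_fund_nonneg by (lia || lra); reflexivity.
Qed.

Lemma unit_solution_ode n c a b A B T t :
  (1 <= n)%nat ->
  unit_solution n c a b A B T n t = c * unit_solution n c a b A B T O t + 1.
Proof.
intros hn; unfold unit_solution; rewrite comb_ode by exact hn.
replace (1 + n)%nat with (n + 1)%nat by lia; rewrite fund_shift1 by exact hn.
simpl Nat.add; ring.
Qed.

Lemma unit_solution_space n c a b A B T :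
  (1 <= n)%nat -> a < b -> (length A + length B = n)%nat ->
  (forall i, In i A -> (i < n)%nat) -> (forall i, In i B -> (i < n)%nat) ->
  bvp_inverse n c a b A B T ->
  space_X n a b A B (unit_solution n c a b A B T).
Proof.
intros hn hab hAB HA HB HT.
assert (Hd : forall i t,
  is_derive (unit_solution n c a b A B T i) t (unit_solution n c a b A B T (S i) t)).
{ intros i t.
  apply (is_derive_minus (K := R_AbsRing) (V := R_NormedModule)
    (fun t => fund n c (1 + i) (t - a)) (comb n c a (correction n c a b A B T 1 a) i)).
  - replace (1 + S i)%nat with (S (1 + i)) by lia; now apply fund_shift_derive.
  - now apply comb_derive. }
split; [split|].
- intros i t _ ht; apply is_derive_derive_on; auto.
- apply continuous_on_forall; intros t _.
  apply (ex_derive_continuous (K := R_AbsRing) (V := R_NormedModule)); eexists; apply Hd.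
- apply boundary_conditions; rewrite hAB; intros j hj.
  rewrite unit_solution_response; [now apply response_boundary| |];
    destruct (condition_cases a b A B j ltac:(lia)) as [[h E]|[h E]]; auto; rewrite E; lra.
Qed.

(* For [s] close to [b], [response 0] cannot vanish before [s]: it would be the
   solution started at [s], whose derivatives are positive just after [s]. *)
Lemma response0_nonzero n c a b A B T :
  (1 <= n)%nat -> a < b -> (length A + length B = n)%nat ->
  (forall i, In i B -> (i < n)%nat) -> B <> nil -> bvp_inverse n c a b A B T ->
  exists s, a < s < b /\
    exists t, a <= t < s /\ response n c a b A B T 0 0 s t <> 0.
Proof.
intros hn hab hAB HB hBn HT.
destruct (fund_pos n c hn) as [d [hd Hd]].
set (h := Rmin d (b - a) / 2).
assert (hm : 0 < Rmin d (b - a)) by (apply Rmin_glb_lt; lra).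
pose proof (Rmin_l d (b - a)); pose proof (Rmin_r d (b - a)).
assert (hs : a < b - h < b) by (unfold h; lra).
exists (b - h); split; [exact hs|].
apply NNPP; intros Hno.
destruct B as [|j B']; [easy|].
set (B := j :: B') in *.
assert (Hj : response n c a b A B T 0 j (b - h) b = 0).
{ apply (proj2 (response0_space n c a b A B T (b - h) hn hAB HT)); now left. }
unfold response in Hj.
replace (b - (b - h)) with h in Hj by ring.
rewrite step_fund_pos in Hj by (unfold h; lra).
assert (hj : (j < n)%nat) by (apply HB; now left).
(* Before the source the response is minus a homogeneous solution; if it vanishes there, its initial
   data do. A condition at b then reads K^(j)(h) = 0, against [fund_pos]. *)
assert (Hz : forall l, (l < n)%nat -> correction n c a b A B T 0 (b - h) l = 0).
{ intros l hl; rewrite <- (comb_initial n c a _ l hl).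
  apply (zero_derivatives n a ((a + (b - h)) / 2)
    (comb n c a (correction n c a b A B T 0 (b - h)))); [lra| | |lia|split; lra].
  - intros i t _ ht; apply is_derive_derive_on, comb_derive; auto.
  - intros t [ht1 ht2]; apply NNPP; intros hne; apply Hno; exists t; split; [lra|].
    unfold response; rewrite step_fund_neg by lra; lra. }
rewrite (comb_ext n c a _ (fun _ => 0)) in Hj by exact Hz.
unfold comb in Hj; rewrite rsum_zero in Hj by (intros; ring).
specialize (Hd (0 + j)%nat h ltac:(lia) ltac:(unfold h; lra)); lra.
Qed.

(** * Comparison and the first eigenvalue *)

Lemma cont_in_max a b f :
  a <= b -> (forall t, segment a b t -> cont_in (segment a b) f t) ->
  exists x, segment a b x /\ forall t, segment a b t -> f t <= f x.
Proof.
intros hab H.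
destruct (continuity_ab_maj (fun z => f (Rmax a (Rmin b z))) a b hab) as [x [Hx hx]].
- intros c _; now apply clamp_continuity.
- exists x; split; [exact hx|]; intros t ht; specialize (Hx t ht); simpl in Hx.
  destruct ht; rewrite !Rmin_right, !Rmax_right in Hx by lra; exact Hx.
Qed.

(** With y = 0 this also serves for scaling, whence the summands with coefficient 0 further on. *)
Lemma space_X_comb n a b A B U V x y :
  space_X n a b A B U -> space_X n a b A B V ->
  space_X n a b A B (fun i t => x * U i t + y * V i t).
Proof.
intros [[HU HUc] [HUa HUb]] [[HV HVc] [HVa HVb]]; split; [split|split].
- intros i t hi ht; apply is_derive_on_plus; apply is_derive_on_scal; auto.
- intros t ht.
  apply (cont_in_plus _ (fun t => x * U n t) (fun t => y * V n t)).
  + apply (cont_in_mult _ (fun _ => x) (U n)); [apply cont_in_const|exact (HUc t ht)].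
  + apply (cont_in_mult _ (fun _ => y) (V n)); [apply cont_in_const|exact (HVc t ht)].
- intros i hi; rewrite HUa, HVa by exact hi; ring.
- intros i hi; rewrite HUb, HVb by exact hi; ring.
Qed.

Lemma space_X_cont n a b A B U t :
  (1 <= n)%nat -> space_X n a b A B U -> segment a b t ->
  cont_in (segment a b) (U O) t.
Proof.
intros hn [[HU _] _] ht; apply is_derive_on_cont with (U 1%nat t); [exact ht|].
apply HU; [lia|exact ht].
Qed.

Definition sgn (B : list nat) : R := (-1) ^ length B.

Lemma sgn_sq B : sgn B * sgn B = 1.
Proof.
unfold sgn; rewrite <- pow_add; replace (length B + length B)%nat with (2 * length B)%nat by lia.
apply pow_1_even.
Qed.

(* Such a [W] exists exactly when [mu] lies below the first eigenvalue. *)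
Definition certificate (n : nat) (a b : R) (A B : list nat) (mu r : R)
    (W : nat -> R -> R) : Prop :=
  space_X n a b A B W /\
  forall t, segment a b t ->
    0 <= W O t <= r /\ sgn B * W n t = 1 + mu * W O t.

Section Comparison.
Context (n : nat) (a b : R) (A B : list nat).
Context (hn : (1 <= n)%nat) (hab : a < b) (hAB : admissible n A B).

(* A bound [-C W <= U] improves itself to [-C (1 - eta) W <= U]. *)
Lemma comparison mu mu' r W U :
  0 <= mu -> 0 <= mu' -> 0 <= r -> (mu' - mu) * (r + 1) <= 1 / 2 ->
  certificate n a b A B mu r W ->
  space_X n a b A B U ->
  (forall t, segment a b t -> mu' * U O t <= sgn B * U n t) ->
  forall t, segment a b t -> 0 <= U O t.
Proof.
intros hmu hmu' hr hclose [HWX HW] HUX HU t ht.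
(* Positivity for M = 0, applied to U + D W: a lower bound on mu' U gives a lower bound on U. *)
assert (Hstep : forall C D,
  (forall t, segment a b t -> 0 <= mu' * U O t + D * (1 + mu * W O t)) ->
  C = D -> forall t, segment a b t -> - (C * W O t) <= U O t).
{ intros C D HD -> x hx.
  enough (0 <= 1 * U O x + D * W O x) by lra.
  apply (positivity n a b A B _ hAB (space_X_comb _ _ _ _ _ _ _ 1 D HUX HWX)); [|exact hx].
  intros y hy; fold (sgn B); specialize (HD y hy); specialize (HU y hy);
    destruct (HW y hy) as [_ Ey].
  replace (sgn B * (1 * U n y + D * W n y)) with (sgn B * U n y + D * (sgn B * W n y)) by ring.
  rewrite Ey; lra. }
assert (hmr : 0 <= mu * r) by (apply Rmult_le_pos; lra).
(* Inserting U >= - D W leaves D (1 - eta - (mu' - mu) W - eta mu W) to be nonnegative. The middle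
   term is at most 1/2 by the closeness hypothesis, and eta (1 + mu r) = 1/2 uses up the rest. *)
set (eta := / (2 * (1 + mu * r))).
assert (heta : eta * (1 + mu * r) = 1 / 2) by (unfold eta; field; lra).
assert (heta0 : 0 < eta) by (unfold eta; apply Rinv_0_lt_compat; lra).
assert (heta1 : eta <= 1 / 2) by nra.
destruct (cont_in_bounded a b (U O)) as [rho [hrho Hrho]];
  [lra|intros; eapply space_X_cont; eauto|].
(* The iteration starts from the crude bound mu' U >= - mu' rho. *)
set (C := mu' * rho).
assert (hC : 0 <= C) by (apply Rmult_le_pos; lra).
assert (Hk : forall k t, segment a b t -> - (C * (1 - eta) ^ k * W O t) <= U O t).
{ induction k as [|k IH].
  - simpl; rewrite Rmult_1_r; apply (Hstep C C); [|reflexivity].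
    intros x hx; destruct (HW x hx) as [[h1 _] _]; specialize (Hrho x hx).
    apply Rabs_le_between in Hrho.
    assert (0 <= mu * W O x) by (apply Rmult_le_pos; lra).
    assert (mu' * - rho <= mu' * U O x) by (apply Rmult_le_compat_l; lra).
    assert (0 <= C * (mu * W O x)) by (apply Rmult_le_pos; lra).
    unfold C in *; nra.
  - apply Hstep with (D := (C * (1 - eta) ^ k * (1 - eta))); [|simpl; ring].
    intros x hx; specialize (IH x hx); destruct (HW x hx) as [[h1 h2] _].
    set (D := C * (1 - eta) ^ k) in *.
    assert (hD : 0 <= D) by (apply Rmult_le_pos; [lra|apply pow_le; lra]).
    assert (H1 : mu' * - (D * W O x) <= mu' * U O x) by (apply Rmult_le_compat_l; lra).
    assert (H2 : (mu' - mu) * W O x <= 1 / 2).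
    { destruct (Rle_lt_dec mu mu').
      - eapply Rle_trans; [|exact hclose]; apply Rmult_le_compat_l; lra.
      - nra. }
    assert (H3 : eta * (mu * W O x) <= eta * (mu * r)).
    { apply Rmult_le_compat_l; [lra|]; apply Rmult_le_compat_l; lra. }
    assert (H4 : 0 <= D * ((1 - eta) - (mu' - mu) * W O x - eta * (mu * W O x))).
    { apply Rmult_le_pos; [lra|]; nra. }
    nra. }
destruct (Rle_lt_dec 0 (U O t)) as [|hlt]; [assumption|exfalso].
destruct (HW t ht) as [[h1 h2] _].
assert (hCr : 0 <= C * r) by (apply Rmult_le_pos; lra).
(* The bound C (1 - eta)^N r tends to 0 and so excludes a negative value; the + 1 keeps the
   denominator positive. *)
destruct (pow_lt_1_zero (1 - eta)) with (y := - U O t / (C * r + 1)) as [N HN].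
- rewrite Rabs_pos_eq; lra.
- apply Rdiv_lt_0_compat; lra.
- specialize (HN N (le_n N)); specialize (Hk N t ht).
  assert (hp : 0 <= (1 - eta) ^ N) by (apply pow_le; lra).
  rewrite Rabs_pos_eq in HN by exact hp.
  assert (H1 : (C * r + 1) * (1 - eta) ^ N < - U O t).
  { apply Rmult_lt_compat_l with (r := C * r + 1) in HN; [|lra].
    replace ((C * r + 1) * (- U O t / (C * r + 1))) with (- U O t) in HN by (field; lra).
    exact HN. }
  assert (H2 : C * (1 - eta) ^ N * W O t <= C * (1 - eta) ^ N * r).
  { apply Rmult_le_compat_l; [apply Rmult_le_pos; lra|lra]. }
  nra.
Qed.

(** [comparison] applies to an eigenfunction and to its negative, so the eigenfunction vanishes. *)
Lemma certificate_not_eigenvalue mu mu' r W :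
  0 <= mu -> 0 <= mu' -> 0 <= r -> (mu' - mu) * (r + 1) <= 1 / 2 ->
  certificate n a b A B mu r W -> ~ eigenvalue n a b A B (- (sgn B * mu')).
Proof.
intros hmu hmu' hr hclose HW [U [HUX [[t [ht Hne]] HU]]].
pose proof (sgn_sq B) as hs.
assert (HU' : forall x, segment a b x -> sgn B * U n x = mu' * U O x).
{ intros x hx; specialize (HU x hx).
  replace (U n x) with (sgn B * mu' * U O x) by lra.
  replace (sgn B * (sgn B * mu' * U O x)) with (sgn B * sgn B * (mu' * U O x)) by ring.
  rewrite hs; ring. }
pose proof (comparison mu mu' r W U hmu hmu' hr hclose HW HUX
  ltac:(intros; rewrite HU' by assumption; lra) t ht).
pose proof (comparison mu mu' r W _ hmu hmu' hr hclose HW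
  (space_X_comb _ _ _ _ _ _ _ (-1) 0 HUX HUX)) as H'.
assert (0 <= -1 * U O t + 0 * U O t); [|lra].
apply H'; [|exact ht]; intros x hx; specialize (HU' x hx); simpl; nra.
Qed.

(** With e = [sgn B] and c = e mu, multiplying u^(n) = c u + 1 by e^2 = 1 gives the required
    equation for w = e u. *)
Lemma unit_load_exists mu :
  ~ eigenvalue n a b A B (- (sgn B * mu)) ->
  exists W, space_X n a b A B W /\
    forall t, segment a b t -> sgn B * W n t = 1 + mu * W O t.
Proof.
intros Hne; destruct hAB as (_ & _ & HA & HB & hlen & _).
destruct (bvp_inverse_exists n (sgn B * mu) a b A B hn hab hlen HA HB Hne) as [T HT].
pose proof (unit_solution_space n (sgn B * mu) a b A B T hn hab hlen HA HB HT) as HV.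
eexists; split; [exact (space_X_comb _ _ _ _ _ _ _ (sgn B) 0 HV HV)|].
intros t ht; simpl; rewrite unit_solution_ode by exact hn.
pose proof (sgn_sq B) as hs.
set (v := unit_solution _ _ _ _ _ _ _ O t).
replace (sgn B * (sgn B * (sgn B * mu * v + 1) + 0 * (sgn B * mu * v + 1)))
  with ((sgn B * sgn B) * (sgn B * mu * v + 1)) by ring.
rewrite hs; ring.
Qed.

Definition subcritical (mu : R) : Prop :=
  0 <= mu /\ exists r W, 0 <= r /\ certificate n a b A B mu r W.

(** The solution with unit load at mu' exists and is nonnegative by comparison with the certificate
    at mu. For mu' <= mu the closeness hypothesis holds by itself, so the same lemma moves
    downwards. *)
Lemma subcritical_extend mu mu' r W :
  0 <= mu -> 0 <= mu' -> 0 <= r -> (mu' - mu) * (r + 1) <= 1 / 2 ->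
  certificate n a b A B mu r W -> subcritical mu'.
Proof.
intros hmu hmu' hr hclose HW.
destruct (unit_load_exists mu') as [V [HVX HV]].
{ eapply certificate_not_eigenvalue with (mu := mu); eauto. }
destruct (cont_in_bounded a b (V O)) as [rho [hrho Hrho]];
  [lra|intros; eapply space_X_cont; eauto|].
split; [exact hmu'|]; exists rho, V; split; [exact hrho|]; split; [exact HVX|].
intros t ht; split; [|now apply HV].
split.
- apply (comparison mu mu' r W V); auto; intros x hx; rewrite HV by exact hx; lra.
- specialize (Hrho t ht); apply Rabs_le_between in Hrho; lra.
Qed.

Lemma subcritical_0 : subcritical 0.
Proof.
assert (Hne : ~ eigenvalue n a b A B (- (sgn B * 0))).
{ intros [U [HUX [[t [ht Hne]] HU]]].
  pose proof (positivity n a b A B U hAB HUX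
    ltac:(intros x hx; specialize (HU x hx); fold (sgn B); nra) t ht).
  assert (0 <= -1 * U O t + 0 * U O t); [|lra].
  apply (positivity n a b A B _ hAB (space_X_comb _ _ _ _ _ _ _ (-1) 0 HUX HUX)); [|exact ht].
  intros x hx; specialize (HU x hx); fold (sgn B); nra. }
destruct (unit_load_exists 0 Hne) as [V [HVX HV]].
destruct (cont_in_bounded a b (V O)) as [rho [hrho Hrho]];
  [lra|intros; eapply space_X_cont; eauto|].
split; [lra|]; exists rho, V; split; [exact hrho|]; split; [exact HVX|].
intros t ht; split; [|now apply HV].
split.
- apply (positivity n a b A B V hAB HVX); [|exact ht].
  intros x hx; fold (sgn B); rewrite HV by exact hx; lra.
- specialize (Hrho t ht); apply Rabs_le_between in Hrho; lra.
Qed.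

Lemma subcritical_le mu mu' : 0 <= mu' <= mu -> subcritical mu -> subcritical mu'.
Proof.
intros h [hmu [r [W [hr HW]]]].
apply subcritical_extend with mu r W; auto; try lra; nra.
Qed.

Lemma subcritical_not_eigenvalue mu :
  subcritical mu -> ~ eigenvalue n a b A B (- (sgn B * mu)).
Proof.
intros [hmu [r [W [hr HW]]]]; apply certificate_not_eigenvalue with mu r W; auto; lra.
Qed.

Lemma first_eigenvalue :
  (exists m, forall mu, subcritical mu -> mu <= m) ->
  exists mu1, eigenvalue n a b A B (- (sgn B * mu1)) /\
    forall mu, subcritical mu <-> 0 <= mu < mu1.
Proof.
intros [m Hm].
destruct (completeness subcritical) as [mu1 [Hub Hlub]];
  [exists m; exact Hm|exists 0; exact subcritical_0|].
assert (hmu1 : 0 <= mu1) by (apply Hub, subcritical_0).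
assert (Hnot : ~ subcritical mu1).
{ intros [_ [r [W [hr HW]]]].
  assert (h : 0 < / (2 * (r + 1))) by (apply Rinv_0_lt_compat; lra).
  assert (H : subcritical (mu1 + / (2 * (r + 1)))).
  { apply subcritical_extend with mu1 r W; auto; try lra.
    right; field; lra. }
  apply Hub in H; lra. }
assert (Happrox : forall d, 0 < d -> exists mu, subcritical mu /\ mu1 - d < mu).
{ intros d hd; apply NNPP; intros Hno.
  assert (mu1 <= mu1 - d); [|lra].
  apply Hlub; intros mu Hmu; destruct (Rle_lt_dec mu (mu1 - d)); [assumption|].
  exfalso; apply Hno; eauto. }
exists mu1; split.
- apply NNPP; intros Hne; apply Hnot.
  destruct hAB as (_ & _ & HA & HB & hlen & _).
  destruct (bvp_inverse_exists n (sgn B * mu1) a b A B hn hab hlen HA HB Hne) as [T HT].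
  destruct (bvp_estimate n (sgn B * mu1) a b A B T hn hab hlen HA HB HT) as [C [hC HC]].
  (* The distance is fitted to r = 2 C, the bound obtained below for the certificate at mu, so that
     one extension step from mu reaches mu1. *)
  destruct (Happrox (/ (2 * (2 * C + 1)))) as [mu [Hmu hlt]];
    [apply Rinv_0_lt_compat; lra|].
  pose proof (Hub mu Hmu) as hle.
  destruct Hmu as [hmu [r [W [_ [HWX HW]]]]].
  assert (hd : (mu1 - mu) * (2 * C + 1) <= 1 / 2).
  { apply Rle_trans with (/ (2 * (2 * C + 1)) * (2 * C + 1)).
    - apply Rmult_le_compat_r; lra.
    - right; field; lra. }
  destruct (cont_in_max a b (W O)) as [x [hx Hx]];
    [lra|intros; eapply space_X_cont; eauto|].
  pose proof (HW x hx) as [[hW0 _] _].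
  (* At mu1 the function W solves the problem with load e (1 - (mu1 - mu) W), to which the estimate
     applies with x the maximum point of W. *)
  assert (Hbd : Rabs (W O x) <= C * (1 + (mu1 - mu) * W O x)).
  { apply (HC W (1 + (mu1 - mu) * W O x)); auto; [nra|].
    intros t ht; destruct (HW t ht) as [[h1 _] h2].
    replace (W n t - sgn B * mu1 * W O t) with
      ((sgn B * sgn B) * W n t - sgn B * mu1 * W O t) by (rewrite sgn_sq; ring).
    replace (sgn B * sgn B * W n t - sgn B * mu1 * W O t) with
      (sgn B * (1 - (mu1 - mu) * W O t)) by (rewrite Rmult_assoc, h2; ring).
    rewrite Rabs_mult.
    assert (Rabs (sgn B) = 1) as -> by (unfold sgn; apply pow_1_abs).
    specialize (Hx t ht).
    assert ((mu1 - mu) * W O t <= (mu1 - mu) * W O x) by (apply Rmult_le_compat_l; lra).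
    assert (0 <= (mu1 - mu) * W O t) by (apply Rmult_le_pos; lra).
    rewrite Rmult_1_l; apply Rabs_le; lra. }
  rewrite Rabs_pos_eq in Hbd by exact hW0.
  (* The term C (mu1 - mu) W is small enough to be absorbed on the left. *)
  assert (hr : W O x <= 2 * C).
  { assert ((mu1 - mu) * (2 * C) <= 1 / 2) by nra.
    assert ((mu1 - mu) * (2 * C) * W O x <= 1 / 2 * W O x) by (apply Rmult_le_compat_r; lra).
    nra. }
  apply subcritical_extend with mu (2 * C) W; auto; try lra.
  split; [exact HWX|]; intros t ht; specialize (Hx t ht).
  destruct (HW t ht) as [[h1 _] h2]; repeat split; auto; lra.
- intros mu; split.
  + intros Hmu; split; [apply Hmu|].
    destruct (Hub mu Hmu) as [|E]; [assumption|exfalso; subst; now apply Hnot].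
  + intros [h1 h2]; destruct (Happrox (mu1 - mu)) as [nu [Hnu hlt]]; [lra|].
    apply subcritical_le with nu; [lra|exact Hnu].
Qed.

End Comparison.

(** * Reduction to order q *)

(** Downward induction on the order: each derivative starts nonnegative at x and increases. *)
Lemma nonneg_descend n q x y (U : nat -> R -> R) :
  (forall i t, (i < n)%nat -> segment x y t ->
     is_derive_on (segment x y) (U i) t (U (S i) t)) ->
  (forall i, (q <= i < n)%nat -> 0 <= U i x) ->
  (forall t, segment x y t -> 0 <= U n t) ->
  forall i t, (q <= i <= n)%nat -> segment x y t -> 0 <= U i t.
Proof.
intros HU Hx Hn.
assert (H : forall j t, (q + j <= n)%nat -> segment x y t -> 0 <= U (n - j)%nat t).
{ induction j as [|j IH]; intros t hj ht; [rewrite Nat.sub_0_r; now apply Hn|].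
  apply Rle_trans with (U (n - S j)%nat x); [apply Hx; lia|].
  apply (increasing_on x y (U (n - S j)%nat) (U (n - j)%nat)); try (destruct ht; lra).
  - intros u hu; replace (n - j)%nat with (S (n - S j)) by lia; apply HU; [lia|exact hu].
  - intros u hu; apply IH; [lia|destruct ht; split; lra]. }
intros i t hi ht; replace i with (n - (n - i))%nat by lia; apply H; [lia|exact ht].
Qed.

(* All the conditions of order at least [q] are imposed at [a], so that [u^(q)]
   solves an initial value problem and [u] is recovered from [u^(q)] by a problem
   of order [q] of the same kind. *)
Definition splits (n q : nat) (A A' B : list nat) : Prop :=
  (1 <= q < n)%nat /\ admissible n A B /\ admissible q A' B /\
  (forall i, In i A' -> In i A) /\ (forall i, (q <= i < n)%nat -> In i A) /\ B <> nil.

Section Split.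
Context (n q : nat) (a b : R) (A A' B : list nat).
Context (hab : a < b) (Hsp : splits n q A A' B).

Lemma split_space U : space_X n a b A B U -> space_X q a b A' B U.
Proof.
destruct Hsp as (hq & _ & _ & HA & _ & _).
intros [[HU HUc] [Ha Hb]]; split; [split|split]; auto.
- intros i t hi; apply HU; lia.
- intros t ht; apply (is_derive_on_cont (segment a b) (U q) t (U (S q) t) ht).
  apply HU; [lia|exact ht].
Qed.

Lemma split_positivity U :
  space_X q a b A' B U -> (forall t, segment a b t -> 0 <= U q t) ->
  forall t, segment a b t -> 0 <= sgn B * U O t.
Proof.
destruct Hsp as (_ & _ & HA' & _).
intros HU Hq t ht; replace (sgn B * U O t) with (sgn B * U O t + 0 * U O t) by ring.
apply (positivity q a b A' B _ HA' (space_X_comb _ _ _ _ _ _ _ (sgn B) 0 HU HU)); [|exact ht].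
intros x hx; fold (sgn B).
replace (sgn B * (sgn B * U q x + 0 * U q x)) with ((sgn B * sgn B) * U q x) by ring.
rewrite sgn_sq, Rmult_1_l; now apply Hq.
Qed.

Lemma split_descend U :
  space_X n a b A B U -> (forall t, segment a b t -> 0 <= U n t) ->
  forall i t, (q <= i <= n)%nat -> segment a b t -> 0 <= U i t.
Proof.
destruct Hsp as (_ & _ & _ & _ & HA & _).
intros [[HU _] [Ha _]] Hn; apply nonneg_descend; auto.
intros i hi; rewrite Ha by auto; lra.
Qed.

(** The number Y = u^(q)(s) is bounded below in terms of itself. Since u^(q) >= (Y / (b - a)) max(t
    - s, 0), the problem of order q gives w >= (Y / (b - a)) delta near a point t1 < s, and
    integrating u^(n) = 1 + mu w from t1 gives Y >= K0 + mu (Y / (b - a)) delta K0. Dividing by Y >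
    0 bounds mu. *)
Lemma subcritical_bounded :
  exists m, forall mu, subcritical n a b A B mu -> mu <= m.
Proof.
destruct Hsp as (hq & HAn & HAq & _ & HA & HBn).
assert (Hne : ~ eigenvalue q a b A' B (- 0)).
{ replace (- 0) with (- (sgn B * 0)) by ring.
  apply (subcritical_not_eigenvalue q a b A' B); auto; try lia.
  apply subcritical_0; auto; lia. }
pose proof HAq as (_ & _ & HA'l & HBl & hlen & _).
destruct (bvp_inverse_exists q 0 a b A' B ltac:(lia) hab hlen HA'l HBl Hne) as [T HT].
destruct (response0_nonzero q 0 a b A' B T ltac:(lia) hab hlen HBl HBn HT)
  as [s [hs [t1 [ht1 hne]]]].
pose proof (response0_space q 0 a b A' B T s ltac:(lia) hlen HT) as HZ.
set (Z := fun i => response q 0 a b A' B T 0 i s) in *.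
change (Z O t1 <> 0) in hne.
assert (HZq : forall t, Z q t = Rmax 0 (t - s)).
{ intros t; unfold Z; rewrite response0_ode by lia; ring. }
assert (Hz : forall t, segment a b t -> 0 <= sgn B * Z O t).
{ apply split_positivity; [exact HZ|]; intros t _; rewrite HZq; apply Rmax_l. }
assert (hz1 : 0 < sgn B * Z O t1).
{ destruct (Hz t1 ltac:(split; lra)) as [h|h]; [exact h|exfalso; apply hne].
  rewrite <- (Rmult_1_l (Z O t1)), <- (sgn_sq B), Rmult_assoc, <- h; ring. }
(* Half of the value at t1, so that by continuity e Z exceeds [delta] near t1. *)
set (delta := sgn B * Z O t1 / 2).
assert (hdelta : 0 < delta) by (unfold delta; lra).
assert (Hc : cont_in (segment a b) (fun t => sgn B * Z O t) t1).
{ apply cont_in_mult; [apply cont_in_const|].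
  apply space_X_cont with q A' B; [lia|exact HZ|split; lra]. }
destruct (proj1 (cont_in_eps _ _ _) Hc delta hdelta) as [d [hd Hd]].
destruct (fund_pos n 0 ltac:(lia)) as [d2 [hd2 Hd2]].
set (m0 := Rmin (Rmin d d2) (s - t1)).
assert (hm0 : 0 < m0) by (repeat apply Rmin_glb_lt; lra).
pose proof (Rmin_l (Rmin d d2) (s - t1)); pose proof (Rmin_r (Rmin d d2) (s - t1)).
pose proof (Rmin_l d d2); pose proof (Rmin_r d d2).
fold m0 in H, H0.
set (h := m0 / 2).
assert (hh : 0 < h) by (unfold h; lra).
assert (hht : t1 + h < s) by (unfold h; lra).
set (K0 := fund n 0 (1 + q) h).
assert (hK0 : 0 < K0) by (apply Hd2; [lia|unfold h; lra]).
exists ((b - a) / (delta * K0)); intros mu [hmu [r [W [hr [HWX HW]]]]].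
set (V := fun i t => sgn B * W i t + 0 * W i t).
pose proof (space_X_comb _ _ _ _ _ _ _ (sgn B) 0 HWX HWX : space_X n a b A B V) as HVX.
assert (HVn : forall t, segment a b t -> V n t = 1 + mu * W O t).
{ intros t ht; unfold V; destruct (HW t ht) as [_ ->]; ring. }
assert (HVpos : forall i t, (q <= i <= n)%nat -> segment a b t -> 0 <= V i t).
{ apply split_descend; [exact HVX|]; intros t ht; rewrite HVn by exact ht.
  destruct (HW t ht) as [[h1 _] _]; assert (0 <= mu * W O t) by (apply Rmult_le_pos; lra); lra. }
assert (HVmono : forall t u, a <= t -> t <= u -> u <= b -> V q t <= V q u).
{ intros t u ht htu hu; apply (increasing_on a b (V q) (V (S q))); auto.
  - intros x hx; apply (proj1 HVX); [lia|exact hx].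
  - intros x hx; apply HVpos; [lia|split; lra]. }
set (Y := V q s).
assert (hY : 0 <= Y) by (apply HVpos; [lia|split; lra]).
set (k := Y / (b - a)).
assert (hk : 0 <= k) by (apply Rdiv_le_0_compat; lra).
assert (hkY : k * (b - a) = Y) by (unfold k; field; lra).
(* Before s the load of Z vanishes and V^(q) >= 0; after s monotonicity gives V^(q) >= Y >= k (x -
   s). *)
assert (HWz : forall t, segment a b t -> k * (sgn B * Z O t) <= W O t).
{ intros t ht.
  enough (0 <= 1 * W O t + - (k * sgn B) * Z O t) by lra.
  apply (positivity q a b A' B _ HAq
    (space_X_comb _ _ _ _ _ _ _ 1 (- (k * sgn B)) (split_space W HWX) HZ)); [|exact ht].
  intros x hx; fold (sgn B).
  replace (sgn B * (1 * W q x + - (k * sgn B) * Z q x)) with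
    (V q x - k * ((sgn B * sgn B) * Z q x)) by (unfold V; ring).
  rewrite sgn_sq, HZq.
  destruct (Rle_lt_dec x s).
  - rewrite Rmax_left by lra; specialize (HVpos q x ltac:(lia) hx); lra.
  - rewrite Rmax_right by lra; destruct hx.
    specialize (HVmono s x ltac:(lra) ltac:(lra) ltac:(lra)); fold Y in HVmono.
    assert (k * (x - s) <= k * (b - a)) by (apply Rmult_le_compat_l; lra); lra. }
set (beta := 1 + mu * (k * delta)).
(* For c = 0, [fund n 0 (1 + i)] is x^(n-i) / (n-i)!; so V is compared with the solution of y^(n) =
   beta started from zero at t1. *)
set (D := fun i t => V i t + - beta * fund n 0 (1 + i) (t - t1)).
assert (HD : 0 <= D q (t1 + h)).
{ apply (nonneg_descend n q t1 (t1 + h) D); [| | |lia|split; lra].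
  - intros i t hi [h1 h2]; unfold D; apply is_derive_on_plus.
    + apply is_derive_on_subset with (segment a b).
      * split; lra.
      * intros x [h3 h4]; split; lra.
      * apply (proj1 HVX); [exact hi|split; lra].
    + apply is_derive_on_scal, is_derive_derive_on; [split; lra|].
      replace (1 + S i)%nat with (S (1 + i)) by lia; apply fund_shift_derive; lia.
  - intros i hi; unfold D; rewrite Rminus_diag, fund_0, kappa_small by lia.
    specialize (HVpos i t1 ltac:(lia) ltac:(split; lra)); lra.
  - intros t [h1 h2]; unfold D; replace (1 + n)%nat with (n + 1)%nat by lia.
    rewrite fund_shift1 by lia; rewrite HVn by (split; lra).
    specialize (HWz t ltac:(split; lra)).
    specialize (Hd t ltac:(split; lra) ltac:(rewrite Rabs_pos_eq; unfold h in *; lra)).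
    apply Rabs_def2 in Hd.
    assert (k * delta <= k * (sgn B * Z O t)) by
      (apply Rmult_le_compat_l; unfold delta in *; lra).
    assert (mu * (k * delta) <= mu * W O t) by (apply Rmult_le_compat_l; lra).
    unfold beta; lra. }
unfold D in HD; replace (t1 + h - t1) with h in HD by ring; fold K0 in HD.
specialize (HVmono (t1 + h) s ltac:(lra) ltac:(lra) ltac:(lra)); fold Y in HVmono.
assert (HY : K0 + mu * k * (delta * K0) <= Y).
{ replace (K0 + mu * k * (delta * K0)) with (beta * K0) by (unfold beta; ring); lra. }
assert (hdK : 0 < delta * K0) by (apply Rmult_lt_0_compat; lra).
assert (hmk : 0 <= mu * k * (delta * K0)) by
  (apply Rmult_le_pos; [apply Rmult_le_pos|]; lra).
assert (hkp : 0 < k) by (unfold k; apply Rdiv_lt_0_compat; lra).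
apply Rmult_le_reg_r with (delta * K0); [exact hdK|].
replace ((b - a) / (delta * K0) * (delta * K0)) with (b - a) by (field; lra).
apply Rmult_le_reg_l with k; [exact hkp|].
rewrite hkY; lra.
Qed.

End Split.

(** * The Green's function *)

Lemma filterlim_rsum {T : Type} (F : (T -> Prop) -> Prop) {FF : Filter F} n
  (f : nat -> T -> R) (l : nat -> R) :
  (forall i, (i < n)%nat -> filterlim (f i) F (locally (l i))) ->
  filterlim (fun x => rsum n (fun i => f i x)) F (locally (rsum n l)).
Proof.
induction n as [|n IH]; intros H; simpl; [apply filterlim_const|].
eapply filterlim_comp_2; [apply IH; auto|apply H; auto|].
apply (filterlim_plus (K := R_AbsRing) (V := R_NormedModule)).
Qed.

Lemma filterlim_Rmult {T : Type} (F : (T -> Prop) -> Prop) {FF : Filter F} f g x y :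
  filterlim f F (locally x) -> filterlim g F (locally y) ->
  filterlim (fun t => f t * g t) F (locally (x * y)).
Proof.
intros Hf Hg; eapply filterlim_comp_2; [exact Hf|exact Hg|].
apply (filterlim_mult (K := R_AbsRing)).
Qed.

Lemma filterlim_Rminus {T : Type} (F : (T -> Prop) -> Prop) {FF : Filter F} f g x y :
  filterlim f F (locally x) -> filterlim g F (locally y) ->
  filterlim (fun t => f t - g t) F (locally (x - y)).
Proof.
intros Hf Hg; eapply (filterlim_comp_2 f (fun t => - g t) Rplus);
  [exact Hf| |apply (filterlim_plus (K := R_AbsRing) (V := R_NormedModule))].
eapply filterlim_comp; [exact Hg|].
apply (filterlim_opp (K := R_AbsRing) (V := R_NormedModule)).
Qed.

Lemma filterlim_within_map {S T : UniformSpace} (D : S -> Prop) (E : T -> Prop)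
  (f : S -> T) x :
  continuous f x -> (forall y, D y -> E (f y)) ->
  filterlim f (within D (locally x)) (within E (locally (f x))).
Proof.
intros Hf HDE P HP; unfold filtermap, within in *.
specialize (Hf _ HP); unfold filtermap in Hf.
revert Hf; apply filter_imp; intros y Hy Dy; apply Hy; auto.
Qed.

(** By the mean value theorem on either side of s, a difference quotient at s is a value of f'
    between y and s, hence close to L. The value f' s itself is arbitrary. *)
Lemma derive_glue a b s f f' L :
  a < s < b -> cont_in (segment a b) f s ->
  (forall t, segment a b t -> t <> s -> is_derive_on (segment a b) f t (f' t)) ->
  (forall e, 0 < e -> exists d, 0 < d /\
     forall t, segment a b t -> t <> s -> Rabs (t - s) < d -> Rabs (f' t - L) < e) ->
  is_derive_on (segment a b) f s L.
Proof.
intros hs Hc Hd HL.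
assert (Hcont : forall t, segment a b t -> cont_in (segment a b) f t).
{ intros t ht; destruct (Req_dec t s) as [->|hne]; [exact Hc|].
  apply is_derive_on_cont with (f' t); auto. }
assert (Hmv : forall x y, a <= x -> x < y -> y <= b -> y <= s \/ s <= x ->
  exists t, x < t < y /\ f y - f x = f' t * (y - x)).
{ intros x y hx hxy hy hxs; apply mvt_segment; [exact hxy| |].
  - intros t [h1 h2]; apply cont_in_subset with (segment a b).
    + intros z [h3 h4]; split; lra.
    + apply Hcont; split; lra.
  - intros t ht; apply is_derive_on_interior with a b; [lra|].
    apply Hd; [split; lra|lra]. }
apply is_derive_on_eps; [split; lra|].
intros e he; destruct (HL e he) as [d [hd HLd]]; exists d; split; [exact hd|].
intros y [hy1 hy2] hyd.
assert (Hgo : forall t, segment a b t -> t <> s -> Rabs (t - s) <= Rabs (y - s) ->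
  f y - f s = f' t * (y - s) ->
  Rabs (f y - f s - (y - s) * L) <= e * Rabs (y - s)).
{ intros t ht hts hle E.
  replace (f y - f s - (y - s) * L) with ((f' t - L) * (y - s)) by (rewrite E; ring).
  rewrite Rabs_mult; apply Rmult_le_compat_r; [apply Rabs_pos|].
  left; apply HLd; auto; lra. }
destruct (total_order_T y s) as [[h|h]|h].
- destruct (Hmv y s) as [t [ht E]]; try lra.
  apply (Hgo t); [split; lra|lra| |lra].
  rewrite !Rabs_left by lra; lra.
- subst y; rewrite !Rminus_diag, Rmult_0_l, Rminus_diag, Rabs_R0; lra.
- destruct (Hmv s y) as [t [ht E]]; try lra.
  apply (Hgo t); [split; lra|lra| |lra].
  rewrite !Rabs_pos_eq by lra; lra.
Qed.

(* A solution of the homogeneous problem off [s] whose derivatives do not jump at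
   [s] is a genuine solution, hence zero. *)
Lemma glued_solution_zero n c a b s A B (D : nat -> R -> R) L :
  (2 <= n)%nat -> a < s < b ->
  (forall i, In i A -> (i < n)%nat) -> (forall i, In i B -> (i < n)%nat) ->
  ~ eigenvalue n a b A B (- c) ->
  (forall i t, (i < n)%nat -> segment a b t -> (i < n - 2)%nat \/ t <> s ->
     is_derive_on (segment a b) (D i) t (D (S i) t)) ->
  (forall i, (i <= n - 2)%nat -> cont_in (segment a b) (D i) s) ->
  (forall e, 0 < e -> exists d, 0 < d /\
     forall t, segment a b t -> t <> s -> Rabs (t - s) < d ->
       Rabs (D (n - 1)%nat t - L) < e) ->
  (forall t, segment a b t -> t <> s -> D n t = c * D O t) ->
  boundary a b A B D ->
  forall i t, (i < n)%nat -> segment a b t -> t <> s -> D i t = 0.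
Proof.
intros hn hs HA HB Hne HD Hc HL Hode [Hba Hbb] i t hi ht hts.
assert (hab : a < b) by lra.
(* Two components are repaired: order n - 1 takes the common limit L at s, and order n is defined by
   the equation. *)
set (U := fun i t => if Nat.leb i (n - 2) then D i t
  else if Nat.eqb i (n - 1) then (if Req_dec_T t s then L else D i t)
  else c * D O t).
assert (HU0 : forall t, U O t = D O t) by reflexivity.
assert (HUD : forall i t, (i < n)%nat -> t <> s -> U i t = D i t).
{ intros j x hj hx; unfold U; destruct (Nat.leb_spec j (n - 2)); [reflexivity|].
  rewrite (proj2 (Nat.eqb_eq j (n - 1))) by lia.
  destruct (Req_dec_T x s); [contradiction|reflexivity]. }
assert (HUn : forall t, U n t = c * D O t).
{ intros x; unfold U; rewrite (proj2 (Nat.leb_gt n (n - 2))) by lia.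
  rewrite (proj2 (Nat.eqb_neq n (n - 1))) by lia; reflexivity. }
assert (HUc0 : forall t, segment a b t -> cont_in (segment a b) (D O) t).
{ intros x hx; destruct (Req_dec x s) as [->|hne]; [apply Hc; lia|].
  apply is_derive_on_cont with (D 1%nat x); [exact hx|]; apply HD; auto; lia. }
assert (HUnc : forall y, segment a b y -> cont_in (segment a b) (U n) y).
{ intros y hy.
  pose proof (cont_in_mult (segment a b) (fun _ => c) (D O) y (cont_in_const _ c y)
    (HUc0 y hy)) as H; unfold cont_in in H; rewrite <- (HUn y) in H.
  exact (filterlim_ext _ _ (fun z => eq_sym (HUn z)) H). }
assert (Hoff : forall i t, (i < n)%nat -> segment a b t -> t <> s ->
  is_derive_on (segment a b) (U i) t (U (S i) t)).
{ intros j x hj hx hxs.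
  replace (U (S j) x) with (D (S j) x).
  - apply (is_derive_on_ext_loc _ (D j) _ _ _ (Rabs (x - s)) hx);
      [apply Rabs_pos_lt; lra| |apply HD; auto].
    intros y _ hy; symmetry; apply HUD; [exact hj|].
    intros ->; rewrite Rabs_minus_sym in hy; lra.
  - destruct (Nat.eq_dec (S j) n) as [E|]; [|symmetry; apply HUD; [lia|exact hxs]].
    rewrite E, HUn; now apply Hode. }
assert (HUs : U (n - 1)%nat s = L).
{ unfold U; rewrite (proj2 (Nat.leb_gt (n - 1) (n - 2))), Nat.eqb_refl by lia.
  destruct (Req_dec_T s s); [reflexivity|contradiction]. }
assert (HUd : forall i t, (i < n)%nat -> segment a b t ->
  is_derive_on (segment a b) (U i) t (U (S i) t)).
{ intros j x hj hx; destruct (Req_dec x s) as [->|hxs]; [|now apply Hoff].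
  destruct (Nat.lt_ge_cases j (n - 2)) as [h|h].
  { unfold U; rewrite (proj2 (Nat.leb_le j (n - 2))), (proj2 (Nat.leb_le (S j) (n - 2))) by lia.
    apply HD; auto. }
  apply derive_glue with (U (S j)); [exact hs| |intros; now apply Hoff|].
  - destruct (Nat.eq_dec j (n - 2)) as [->|hj2].
    + unfold U; rewrite Nat.leb_refl; now apply Hc.
    + replace j with (n - 1)%nat by lia; apply cont_in_eps; intros e he.
      destruct (HL e he) as [d [hd Hd]]; exists d; split; [exact hd|].
      intros y hy hyd; rewrite HUs.
      destruct (Req_dec y s) as [->|hys]; [rewrite HUs, Rminus_diag, Rabs_R0; lra|].
      rewrite HUD by (lia || assumption); auto.
  - intros e he; destruct (Nat.eq_dec j (n - 2)) as [->|hj2].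
    + replace (S (n - 2)) with (n - 1)%nat by lia; rewrite HUs.
      destruct (HL e he) as [d [hd Hd]]; exists d; split; [exact hd|].
      intros y hy hys hyd; rewrite HUD by (lia || assumption); auto.
    + replace (S j) with n by lia.
      destruct (proj1 (cont_in_eps _ _ _) (HUnc s hx) e he) as [d [hd Hd]].
      exists d; split; [exact hd|]; intros y hy _; now apply Hd. }
assert (Hz : forall t, segment a b t -> U O t = 0).
{ intros x hx; apply NNPP; intros hne; apply Hne; exists U; split; [split; [split|split]|split].
  - exact HUd.
  - exact HUnc.
  - intros j hj; rewrite HUD by (auto; lra); auto.
  - intros j hj; rewrite HUD by (auto; lra); auto.
  - eauto.
  - intros y hy; rewrite HUn, HU0; ring. }
rewrite <- HUD by assumption.
apply (zero_derivatives n a b U hab HUd Hz); [lia|exact ht].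
Qed.

Lemma at_left_dist f s l :
  filterlim f (at_left s) (locally l) ->
  forall e, 0 < e -> exists d, 0 < d /\
    forall t, t < s -> Rabs (t - s) < d -> Rabs (f t - l) < e.
Proof.
intros H e he.
destruct (H (ball l (mkposreal e he)) (locally_ball l _)) as [d Hd].
exists d; split; [apply cond_pos|]; intros t ht htd; exact (Hd t htd ht).
Qed.

Lemma at_right_dist f s l :
  filterlim f (at_right s) (locally l) ->
  forall e, 0 < e -> exists d, 0 < d /\
    forall t, s < t -> Rabs (t - s) < d -> Rabs (f t - l) < e.
Proof.
intros H e he.
destruct (H (ball l (mkposreal e he)) (locally_ball l _)) as [d Hd].
exists d; split; [apply cond_pos|]; intros t ht htd; exact (Hd t htd ht).
Qed.

Section Green.
Context (n : nat) (c a b : R) (A B : list nat) (T : nat -> nat -> R).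
Context (hn : (2 <= n)%nat) (hlen : (length A + length B = n)%nat).
Context (HA : forall i, In i A -> (i < n)%nat) (HB : forall i, In i B -> (i < n - 1)%nat).
Context (HT : bvp_inverse n c a b A B T).

Let resp := response n c a b A B T.

(** Conditions at a contribute nothing, as a - s <= 0. Those at b have order at most n - 2, which
    keeps the index of the kernel at most n, so that nothing jumps as s reaches b. *)
Lemma correction_cont p l s :
  (p <= 2)%nat -> segment a b s ->
  cont_in (segment a b) (fun s => correction n c a b A B T p s l) s.
Proof.
intros hp hs; apply cont_in_rsum; intros j hj.
apply cont_in_mult; [|apply cont_in_const].
destruct (condition_cases a b A B j ltac:(lia)) as [[h ->]|[h ->]].
- apply (filterlim_within_ext _ (fun _ => 0)).
  + intros x [hx _]; rewrite step_fund_neg; [reflexivity|lra].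
  + rewrite step_fund_neg by (destruct hs; lra); apply filterlim_const.
- apply continuous_cont_in, (continuous_comp (fun s => b - s) (step_fund n c _)).
  + apply (ex_derive_continuous (K := R_AbsRing) (V := R_NormedModule)); auto_derive; auto.
  + apply step_fund_continuous; [lia|right]; specialize (HB _ h); lia.
Qed.

Lemma response_cont_source p i s t :
  (p <= 2)%nat -> segment a b s -> t <> s \/ (p + i <= n)%nat ->
  cont_in (segment a b) (fun s => resp p i s t) s.
Proof.
intros hp hs H.
apply (cont_in_plus _ (fun s => step_fund n c (p + i) (t - s))
  (fun s => - comb n c a (correction n c a b A B T p s) i t)).
- apply continuous_cont_in, (continuous_comp (fun s => t - s) (step_fund n c _)).
  + apply (ex_derive_continuous (K := R_AbsRing) (V := R_NormedModule)); auto_derive; auto.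
  + apply step_fund_continuous; [lia|]; destruct H; [left; lra|now right].
- assert (Hc : cont_in (segment a b)
    (fun s => -1 * comb n c a (correction n c a b A B T p s) i t) s).
  { apply (cont_in_mult _ (fun _ => -1)); [apply cont_in_const|].
    apply cont_in_rsum; intros l hl; apply cont_in_mult; [|apply cont_in_const].
    now apply correction_cont. }
  revert Hc; unfold cont_in.
  replace (-1 * _) with (- comb n c a (correction n c a b A B T p s) i t) by ring.
  apply filterlim_ext; intros; ring.
Qed.

Lemma response2_joint_cont i p :
  square a b p -> fst p <> snd p \/ (2 + i <= n)%nat ->
  filterlim (fun p => resp 2 i (snd p) (fst p)) (within (square a b) (locally p))
    (locally (resp 2 i (snd p) (fst p))).
Proof.
intros hp H.
assert (Hw : forall f : R * R -> R, continuous f p ->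
  filterlim f (within (square a b) (locally p)) (locally (f p))).
{ intros f Hf P HP; specialize (Hf P HP); unfold filtermap, within in *.
  revert Hf; apply filter_imp; auto. }
unfold resp, response.
apply (filterlim_Rminus _ (fun p : R * R => step_fund n c (2 + i) (fst p - snd p))
  (fun p => comb n c a (correction n c a b A B T 2 (snd p)) i (fst p))).
- apply (Hw (fun p => step_fund n c (2 + i) (fst p - snd p))).
  apply (continuous_comp (fun p : R * R => fst p - snd p) (step_fund n c (2 + i))).
  + apply (continuous_minus (K := R_AbsRing) (V := R_NormedModule) fst snd);
      [apply continuous_fst|apply continuous_snd].
  + apply step_fund_continuous; [lia|]; destruct H; [left; lra|now right].
- apply (filterlim_rsum _ n
    (fun l p => correction n c a b A B T 2 (snd p) l * basis n c a l i (fst p))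
    (fun l => correction n c a b A B T 2 (snd p) l * basis n c a l i (fst p))).
  intros l hl.
  apply (filterlim_Rmult _ (fun p : R * R => correction n c a b A B T 2 (snd p) l)
    (fun p : R * R => basis n c a l i (fst p))).
  + apply (filterlim_comp _ _ _ (snd (A := R) (B := R))
      (fun s => correction n c a b A B T 2 s l) _ (within (segment a b) (locally (snd p)))).
    * apply (filterlim_within_map (square a b) (segment a b) (snd (A := R) (B := R)));
        [apply continuous_snd|intros y hy; apply hy].
    * apply (correction_cont 2 l (snd p)); [lia|apply hp].
  + apply (Hw (fun p => basis n c a l i (fst p))).
    apply (continuous_comp (fst (A := R) (B := R)) (basis n c a l i));
      [apply continuous_fst|].
    apply (ex_derive_continuous (K := R_AbsRing) (V := R_NormedModule)).
    eexists; apply fund_shift_derive; lia.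
Qed.

(** The correction is smooth, so the jump is that of the cut-off kernel, K^(n+1)(0) = 1. *)
Lemma response2_jump s :
  exists l r,
    filterlim (resp 2 (n - 1) s) (at_left s) (locally l) /\
    filterlim (resp 2 (n - 1) s) (at_right s) (locally r) /\ r - l = 1.
Proof.
set (k := comb n c a (correction n c a b A B T 2 s) (n - 1)).
assert (Hk : continuous (fun t => - k t) s).
{ apply (continuous_opp (V := R_NormedModule) k).
  apply (ex_derive_continuous (K := R_AbsRing) (V := R_NormedModule)).
  eexists; apply comb_derive; lia. }
exists (- k s), (1 + - k s); split; [|split; [|ring]].
- apply (filterlim_within_ext _ (fun t => - k t)).
  + intros t ht; unfold resp, response; rewrite step_fund_neg by lra; fold k; ring.
  + intros P HP; specialize (Hk P HP); unfold filtermap, within in *.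
    revert Hk; apply filter_imp; auto.
- apply (filterlim_within_ext _ (fun t => fund n c (S n) (t - s) + - k t)).
  + intros t ht; unfold resp, response; rewrite step_fund_pos by lra.
    replace (2 + (n - 1))%nat with (S n) by lia; reflexivity.
  + assert (Hc : continuous (fun t => fund n c (S n) (t - s) + - k t) s).
    { apply (continuous_plus (K := R_AbsRing) (V := R_NormedModule)
        (fun t => fund n c (S n) (t - s)) (fun t => - k t)); [|exact Hk].
      apply (ex_derive_continuous (K := R_AbsRing) (V := R_NormedModule)).
      eexists; apply fund_shift_derive; lia. }
    unfold continuous in Hc; rewrite Rminus_diag, fund_0, kappa_Sn in Hc by lia.
    intros P HP; specialize (Hc P HP); unfold filtermap, within in *.
    revert Hc; apply filter_imp; auto.
Qed.

Lemma response2_green :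
  is_green n a b (- c) A B (fun i t s => resp 2 i s t).
Proof.
assert (Hsub : forall (E : R * R -> Prop) i,
  (forall p, E p -> square a b p) ->
  (forall p, E p -> fst p <> snd p \/ (2 + i <= n)%nat) ->
  continuous_on E (fun p => resp 2 i (snd p) (fst p))).
{ intros E i HE Hi p hp P HP.
  pose proof (response2_joint_cont i p (HE p hp) (Hi p hp) P HP) as H.
  unfold filtermap, within in *; revert H; apply filter_imp; auto. }
split; [|split; [|split; [|split; [|split]]]].
- intros i t s hi ht _ H; apply is_derive_derive_on; [exact ht|].
  apply response_derive; [lia|]; destruct H; [right; lia|now left].
- intros i hi; apply Hsub; auto; intros; right; lia.
- intros i _; split; apply Hsub; intros p [h1 h2]; auto; left; lra.
- intros s _; apply response2_jump.
- intros t s _ _ _; unfold resp; rewrite response2_ode by lia; ring.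
- intros s _; apply boundary_conditions; rewrite hlen; intros j hj.
  now apply response_boundary.
Qed.

Lemma square_section_cont (f : R -> R -> R) s t :
  continuous_on (square a b) (fun p => f (fst p) (snd p)) ->
  segment a b s -> segment a b t -> cont_in (segment a b) (fun t => f t s) t.
Proof.
intros Hf hs ht; unfold cont_in.
eapply (filterlim_comp _ _ _ (fun t => (t, s)) (fun p => f (fst p) (snd p)));
  [|exact (Hf (t, s) (conj ht hs))].
apply (filterlim_within_map (segment a b) (square a b) (fun t => (t, s))).
- apply (continuous_comp_2 (fun t => t) (fun _ => s) (fun x y => (x, y)));
    [apply continuous_id|apply continuous_const|].
  intros P HP; unfold filtermap; revert HP; apply filter_imp; now intros [x y].
- intros y hy; split; assumption.
Qed.

(** Both functions jump by 1 in order n - 1, so the left and right limits of their difference agree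
    and [glued_solution_zero] applies. *)
Lemma green_unique G :
  ~ eigenvalue n a b A B (- c) -> is_green n a b (- c) A B G ->
  forall i t s, (i < n)%nat -> segment a b t -> a < s < b -> t <> s ->
  G i t s = resp 2 i s t.
Proof.
intros Hne HG i t s hi ht hs hts.
pose proof response2_green as HR.
destruct HG as (HGd & HGc & _ & HGj & HGo & HGb).
destruct HR as (HRd & HRc & _ & HRj & HRo & HRb).
assert (hs' : segment a b s) by (split; lra).
destruct (HGj s hs) as (l & r & Hl & Hr & Elr).
destruct (HRj s hs) as (l' & r' & Hl' & Hr' & Elr').
enough (G i t s + -1 * resp 2 i s t = 0) by lra.
apply (glued_solution_zero n c a b s A B (fun i t => G i t s + -1 * resp 2 i s t) (l - l'));
  auto.
- intros j hj; specialize (HB j hj); lia.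
- intros j x hj hx H; apply is_derive_on_plus; [now apply HGd|].
  apply is_derive_on_scal; now apply HRd.
- intros j hj; apply cont_in_plus;
    [|apply (cont_in_mult _ (fun _ => -1)); [apply cont_in_const|]].
  + apply (square_section_cont (G j)); auto.
  + apply (square_section_cont (fun t s => resp 2 j s t)); auto.
- intros e he.
  destruct (at_left_dist _ _ _ Hl (e / 2) ltac:(lra)) as [d1 [hd1 H1]].
  destruct (at_right_dist _ _ _ Hr (e / 2) ltac:(lra)) as [d2 [hd2 H2]].
  destruct (at_left_dist _ _ _ Hl' (e / 2) ltac:(lra)) as [d3 [hd3 H3]].
  destruct (at_right_dist _ _ _ Hr' (e / 2) ltac:(lra)) as [d4 [hd4 H4]].
  exists (Rmin (Rmin d1 d2) (Rmin d3 d4)); split; [repeat apply Rmin_glb_lt; lra|].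
  intros x _ hx hxd.
  apply Rmin_Rgt_l in hxd as [h h']; apply Rmin_Rgt_l in h as [h1 h2];
    apply Rmin_Rgt_l in h' as [h3 h4].
  destruct (Rtotal_order x s) as [hlt|[E|hgt]]; [|contradiction|].
  + specialize (H1 x hlt h1); specialize (H3 x hlt h3).
    apply Rabs_def2 in H1; apply Rabs_def2 in H3; apply Rabs_def1; lra.
  + specialize (H2 x hgt h2); specialize (H4 x hgt h4).
    apply Rabs_def2 in H2; apply Rabs_def2 in H4; apply Rabs_def1; lra.
- intros x hx hxs; specialize (HGo x s hx hs hxs); specialize (HRo x s hx hs hxs); lra.
- destruct (HGb s hs) as [H1 H2]; destruct (HRb s hs) as [H3 H4]; split; intros j hj.
  + specialize (H1 j hj); specialize (H3 j hj); simpl in *; lra.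
  + specialize (H2 j hj); specialize (H4 j hj); simpl in *; lra.
Qed.

End Green.

(** * Sign of the q-th derivative of the Green's function *)

(** If l < 0, then F'(s + x) - F'(s - x) <= l x < 0 for small x > 0, so F(s + x) + F(s - x) falls
    below 2 F(s). A second derivative is assumed at s only, since the source may be moved across
    t. *)
Lemma second_difference_derive (F F' : R -> R) (s l : R) :
  (forall x, is_derive F x (F' x)) -> is_derive F' s l ->
  (forall h, 0 <= F (s + h) - 2 * F s + F (s - h)) -> 0 <= l.
Proof.
intros HF HF' Hdiff; destruct (Rle_lt_dec 0 l) as [|hl]; [assumption|exfalso].
assert (HFd : is_derive_on (fun _ => True) F' s l) by now apply is_derive_derive_on.
rewrite (is_derive_on_eps (fun _ => True) F' s l I) in HFd.
destruct (HFd (- l / 2) ltac:(lra)) as [d [hd Hd]].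
set (h := d / 2).
destruct (mvt_segment 0 h (fun x => F (s + x) + F (s - x))
  (fun x => F' (s + x) - F' (s - x))) as [x [hx E]].
- unfold h; lra.
- intros t _; apply continuous_cont_in, (ex_derive_continuous (K := R_AbsRing) (V := R_NormedModule)).
  exists (F' (s + t) - F' (s - t)).
  auto_derive; [repeat split; eexists; apply HF|].
  rewrite !(is_derive_unique _ _ _ (HF _)); unfold Rminus; ring.
- intros t _; auto_derive; [repeat split; eexists; apply HF|].
  rewrite !(is_derive_unique _ _ _ (HF _)); unfold Rminus; ring.
- specialize (Hdiff h).
  replace (s + 0) with s in E by ring; replace (s - 0) with s in E by ring.
  pose proof (Hd (s + x) I ltac:(replace (s + x - s) with x by ring;
    rewrite Rabs_pos_eq; unfold h in hx; lra)) as H1.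
  pose proof (Hd (s - x) I ltac:(replace (s - x - s) with (- x) by ring;
    rewrite Rabs_Ropp, Rabs_pos_eq; unfold h in hx; lra)) as H2.
  replace (s + x - s) with x in H1 by ring; replace (s - x - s) with (- x) in H2 by ring.
  rewrite Rabs_Ropp in H2; rewrite (Rabs_pos_eq x) in H1, H2 by lra.
  apply Rabs_le_between in H1; apply Rabs_le_between in H2.
  assert (hneg : F' (s + x) - F' (s - x) < 0) by nra.
  assert (0 < h) by (unfold h; lra).
  nra.
Qed.

(** Convexity of the positive part; the second difference is a tent of half-width |h| centred at
    0. *)
Lemma tent_nonneg x h : 0 <= Rmax 0 (x + h) - 2 * Rmax 0 x + Rmax 0 (x - h).
Proof. unfold Rmax; repeat destruct Rle_dec; lra. Qed.

Lemma decreasing_segment f f' x y :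
  x <= y -> (forall t, segment x y t -> cont_in (segment x y) f t) ->
  (forall t, x < t < y -> is_derive f t (f' t)) ->
  (forall t, x < t < y -> f' t <= 0) -> f y <= f x.
Proof.
intros [hxy|<-] Hc Hd Hn; [|lra].
destruct (mvt_segment x y f f' hxy Hc Hd) as [t [ht E]].
specialize (Hn t ht); nra.
Qed.

Section Sign.
Context (n q : nat) (a b : R) (A A' B : list nat) (mu : R) (T : nat -> nat -> R).
Context (hab : a < b) (Hsp : splits n q A A' B).
Context (HT : bvp_inverse n (sgn B * mu) a b A B T).

Let resp := response n (sgn B * mu) a b A B T.

Lemma split_facts :
  (2 <= n)%nat /\ (length A + length B = n)%nat /\
  (forall i, In i A -> (i < n)%nat) /\ (forall i, In i B -> (i < n - 1)%nat) /\
  (q <= n - 1)%nat /\ B <> nil.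
Proof.
destruct Hsp as (hq & (_ & _ & HA & _ & hlen & _) & (_ & _ & _ & HB & _) & _ & _ & HBn).
repeat split; auto; try lia; intros i hi; specialize (HB i hi); lia.
Qed.

Lemma response_source_deriv0 s t :
  is_derive (fun s => resp 0 q s t) s (- resp 1 q s t).
Proof.
destruct split_facts as (hn & hlen & HA & HB & hq & _).
apply response_derive_source; [lia|right; lia|].
intros j hj; right; destruct (condition_cases a b A B j ltac:(lia)) as [[h _]|[h _]].
- specialize (HA _ h); lia.
- specialize (HB _ h); lia.
Qed.

Lemma response_source_deriv1 s t :
  a < s < b -> t <> s -> is_derive (fun s => resp 1 q s t) s (- resp 2 q s t).
Proof.
destruct split_facts as (hn & hlen & HA & HB & hq & _).
intros hs hts; apply response_derive_source; [lia|now left|].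
intros j hj; left; destruct (condition_cases a b A B j ltac:(lia)) as [[_ h]|[_ h]];
  rewrite h; lra.
Qed.

(** Second differences in s of the ramp response solve the problem with a tent as load. Comparison
    makes e u nonnegative, hence u^(n), hence u^(q); the second derivative in s inherits the sign.
    Endpoints and the diagonal follow by continuity in s. *)
Lemma response2_nonneg :
  subcritical n a b A B mu ->
  forall s t, segment a b s -> segment a b t -> (q = (n - 1)%nat -> t <> s) ->
  0 <= resp 2 q s t.
Proof.
destruct split_facts as (hn & hlen & HA & HB & hq & _).
intros [hmu [r [W [hr HW]]]].
pose proof (proj1 (proj2 Hsp)) as HAB.
assert (Hspace : forall s, space_X n a b A B (fun i => resp 0 i s)) by
  (intros; apply response0_space; (lia || assumption)).
assert (Htent : forall s h t, segment a b t ->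
  0 <= resp 0 q (s + h) t - 2 * resp 0 q s t + resp 0 q (s - h) t).
{ intros s h t ht.
  pose proof (space_X_comb _ _ _ _ _ _ _ 1 1
    (space_X_comb _ _ _ _ _ _ _ 1 (-2) (Hspace (s + h)) (Hspace s)) (Hspace (s - h))) as HUX.
  match type of HUX with space_X _ _ _ _ _ ?V => set (U := V) in HUX end.
  assert (HUn : forall x, U n x = sgn B * mu * U O x +
    (Rmax 0 (x - s + h) - 2 * Rmax 0 (x - s) + Rmax 0 (x - s - h))).
  { intros x; unfold U, resp; rewrite !response0_ode by lia.
    replace (x - (s + h)) with (x - s - h) by ring.
    replace (x - (s - h)) with (x - s + h) by ring; ring. }
  assert (HU0 : forall x, segment a b x -> 0 <= sgn B * U O x).
  { intros x hx; enough (0 <= sgn B * U O x + 0 * U O x) by lra.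
    apply (comparison n a b A B ltac:(lia) hab HAB mu mu r W
      (fun i x => sgn B * U i x + 0 * U i x)); auto; try lra.
    - now apply space_X_comb.
    - intros y hy.
      replace (sgn B * (sgn B * U n y + 0 * U n y)) with ((sgn B * sgn B) * U n y) by ring.
      rewrite sgn_sq, HUn; pose proof (tent_nonneg (y - s) h).
      set (u := U O y) in *.
      replace (mu * (sgn B * u + 0 * u)) with (sgn B * mu * u) by ring; lra. }
  assert (HUq : 0 <= U q t).
  { apply (split_descend n q a b A A' B Hsp U HUX); [|lia|exact ht].
    intros x hx; rewrite HUn; pose proof (tent_nonneg (x - s) h).
    assert (0 <= mu * (sgn B * U O x)) by (apply Rmult_le_pos; auto).
    replace (sgn B * mu * U O x) with (mu * (sgn B * U O x)) by ring; lra. }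
  unfold U in HUq; lra. }
assert (Hint : forall s t, a < s < b -> segment a b t -> t <> s -> 0 <= resp 2 q s t).
{ intros s t hs ht hts.
  apply (second_difference_derive (fun s => resp 0 q s t) (fun s => - resp 1 q s t) s).
  - intros x; apply response_source_deriv0.
  - evar_last; [apply (is_derive_opp (K := R_AbsRing) (V := R_NormedModule)
      (fun s => resp 1 q s t)), response_source_deriv1; assumption|].
    unfold opp; simpl; ring.
  - intros h; now apply Htent. }
intros s t hs ht hts.
destruct (Rle_lt_dec 0 (resp 2 q s t)) as [|hneg]; [assumption|exfalso].
assert (Hc : cont_in (segment a b) (fun s => resp 2 q s t) s).
{ apply (response_cont_source n (sgn B * mu) a b A B T hn hlen HB); [lia|exact hs|].
  destruct (Nat.eq_dec q (n - 1)); [left; auto|right; lia]. }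
destruct (proj1 (cont_in_eps _ _ _) Hc (- resp 2 q s t) ltac:(lra)) as [d [hd Hd]].
(* Two different points are offered, in a direction that stays inside (a, b); at least one of them
   is not t. *)
assert (Hx : exists x, a < x < b /\ t <> x /\ Rabs (x - s) < d).
{ set (m := Rmin d (b - a)).
  assert (hm : 0 < m) by (apply Rmin_glb_lt; lra).
  pose proof (Rmin_l d (b - a)) as hm1; pose proof (Rmin_r d (b - a)) as hm2; fold m in hm1, hm2.
  assert (Hpick : exists k, (k = 1 \/ k = -1) /\ a < s + k * (m / 3) < b /\
    a < s + k * (m / 4) < b).
  { destruct hs; destruct (Rle_lt_dec s ((a + b) / 2)); [exists 1|exists (-1)];
      repeat split; auto; lra. }
  destruct Hpick as [k [hk [h3 h4]]].
  assert (hne : s + k * (m / 3) <> s + k * (m / 4)) by (destruct hk as [->| ->]; lra).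
  assert (Hab : forall u, 0 < u < d -> Rabs (s + k * u - s) < d).
  { intros u hu; replace (s + k * u - s) with (k * u) by ring.
    destruct hk as [->| ->]; apply Rabs_def1; lra. }
  destruct (Req_dec t (s + k * (m / 3))) as [->|].
  - exists (s + k * (m / 4)); repeat split; try lra; apply Hab; lra.
  - exists (s + k * (m / 3)); repeat split; try lra; apply Hab; lra. }
destruct Hx as [x [hx [htx hxd]]].
specialize (Hd x ltac:(split; lra) hxd); specialize (Hint x t hx ht htx).
apply Rabs_def2 in Hd; lra.
Qed.

(** The step and ramp responses vanish for s = b, and their derivatives in s are minus the next
    response; so their q-th derivatives are nonnegative as well. For mu >= 0 the step response with
    source a yields the certificate; for mu < 0 the ramp response yields a contradiction. *)
Lemma subcritical_of_response2_nonneg :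
  (forall s t, a < s < b -> segment a b t -> t <> s -> 0 <= resp 2 q s t) ->
  subcritical n a b A B mu.
Proof.
destruct split_facts as (hn & hlen & HA & HB & hq & HBn).
assert (HB' : forall i, In i B -> (i < n)%nat) by (intros i hi; specialize (HB i hi); lia).
intros Hpos.
assert (Hb : forall p t, (p <= 1)%nat -> segment a b t -> resp p q b t = 0).
{ intros p t hp [ht1 ht2]; unfold resp, response; rewrite step_fund_neg by lra.
  rewrite (comb_ext _ _ _ _ (fun _ => 0)).
  - unfold comb; rewrite rsum_zero by (intros; ring); ring.
  - intros l hl; apply rsum_zero; intros j hj; rewrite step_fund_neg; [ring|].
    destruct (condition_cases a b A B j ltac:(lia)) as [[_ ->]|[_ ->]]; lra. }
assert (Hcont1 : forall t x y, a <= x -> y <= b -> forall u, segment x y u ->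
  cont_in (segment x y) (fun s => resp 1 q s t) u).
{ intros t x y hx hy u [hu1 hu2]; apply cont_in_subset with (segment a b);
    [intros z [h1 h2]; split; lra|].
  apply (response_cont_source n (sgn B * mu) a b A B T hn hlen HB); [lia|split; lra|right; lia]. }
assert (H1 : forall s t, segment a b s -> segment a b t -> 0 <= resp 1 q s t).
{ intros s t [hs1 hs2] [ht1 ht2].
  (* The two sides of s = t are treated separately: for q = n - 1 the step response is not
     differentiable in s there. *)
  assert (Hdec : forall x y, a <= x -> x <= y -> y <= b -> y <= t \/ t <= x ->
    resp 1 q y t <= resp 1 q x t).
  { intros x y hx hxy hy hxt.
    apply (decreasing_segment (fun s => resp 1 q s t) (fun s => - resp 2 q s t)); auto.
    - intros u hu; apply response_source_deriv1; lra.
    - intros u hu; specialize (Hpos u t ltac:(lra) ltac:(split; lra) ltac:(lra)); lra. }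
  destruct (Rle_lt_dec s t).
  - apply Rle_trans with (resp 1 q t t); [|apply Hdec; lra].
    rewrite <- (Hb 1%nat t) by (lia || (split; lra)); apply Hdec; lra.
  - rewrite <- (Hb 1%nat t) by (lia || (split; lra)); apply Hdec; lra. }
destruct (Rle_lt_dec 0 mu) as [hmu|hmu].
- set (V := unit_solution n (sgn B * mu) a b A B T).
  pose proof (unit_solution_space n (sgn B * mu) a b A B T ltac:(lia) hab hlen HA HB' HT
    : space_X n a b A B V) as HVX.
  assert (HV0 : forall t, segment a b t -> 0 <= sgn B * V O t).
  { apply (split_positivity n q a b A A' B Hsp); [now apply (split_space n q a b A A' B)|].
    intros t ht; unfold V; rewrite unit_solution_response by (lia || apply ht).
    apply H1; [split; lra|exact ht]. }
  destruct (cont_in_bounded a b (fun t => sgn B * V O t)) as [r [hr Hr]]; [lra| |].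
  { intros t ht; apply (cont_in_mult _ (fun _ => sgn B)); [apply cont_in_const|].
    apply space_X_cont with n A B; (lia || assumption). }
  split; [exact hmu|].
  exists r, (fun i t => sgn B * V i t + 0 * V i t); split; [exact hr|split].
  + now apply space_X_comb.
  + intros t ht; specialize (HV0 t ht); specialize (Hr t ht).
    apply Rabs_le_between in Hr; split; [lra|].
    replace (sgn B * (sgn B * V n t + 0 * V n t)) with ((sgn B * sgn B) * V n t) by ring.
    rewrite sgn_sq; unfold V; rewrite unit_solution_ode by lia; ring.
- exfalso.
  assert (H0 : forall s t, segment a b s -> segment a b t -> 0 <= resp 0 q s t).
  { intros s t [hs1 hs2] ht; rewrite <- (Hb 0%nat t) by (lia || assumption).
    apply (decreasing_segment (fun s => resp 0 q s t) (fun s => - resp 1 q s t)); auto.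
    - intros u _; apply continuous_cont_in,
        (ex_derive_continuous (K := R_AbsRing) (V := R_NormedModule)).
      eexists; apply response_source_deriv0.
    - intros u _; apply response_source_deriv0.
    - intros u hu; specialize (H1 u t ltac:(split; lra) ht); lra. }
  destruct (response0_nonzero n (sgn B * mu) a b A B T ltac:(lia) hab hlen HB' HBn HT)
    as [s [hs [t0 [ht0 hne]]]].
  set (U := fun i => resp 0 i s).
  assert (HUX : space_X n a b A B U) by (apply response0_space; (lia || assumption)).
  assert (HU0 : forall t, segment a b t -> 0 <= sgn B * U O t).
  { apply (split_positivity n q a b A A' B Hsp); [now apply (split_space n q a b A A' B)|].
    intros t ht; apply H0; [split; lra|exact ht]. }
  assert (HUn : forall t, segment a s t -> U n t = mu * (sgn B * U O t)).
  { intros t [ht1 ht2]; unfold U, resp; rewrite response0_ode, Rmax_left by (lia || lra); ring. }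
  assert (Hsub : forall t, segment a s t -> segment a b t) by (intros t [h1 h2]; split; lra).
  assert (HUd : forall i t, (i < n)%nat -> segment a s t ->
    is_derive_on (segment a s) (U i) t (U (S i) t)).
  { intros i t hi ht; apply is_derive_on_subset with (segment a b); auto.
    apply (proj1 HUX); auto. }
  assert (Hle : forall t, segment a s t -> U q t <= 0).
  { intros t ht; enough (0 <= -1 * U q t) by lra.
    apply (nonneg_descend n q a s (fun i t => -1 * U i t)); [| | |lia|exact ht].
    - intros i x hi hx; apply is_derive_on_scal; auto.
    - intros i hi; rewrite (proj1 (proj2 HUX)); [lra|].
      destruct Hsp as (_ & _ & _ & _ & HAq & _); auto.
    - intros x hx; rewrite HUn by exact hx; specialize (HU0 x (Hsub x hx)); nra. }
  (* [H0] and [Hle] force u^(q) to vanish on [a, s], so u^(n) vanishes there too; as mu is nonzero,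
     so does u. *)
  assert (Hz : forall t, segment a s t -> U n t = 0).
  { intros t ht; replace n with (q + (n - q))%nat by lia.
    apply (zero_derivatives (n - q) a s (fun i => U (q + i)%nat)); [lra| | |lia|exact ht].
    - intros i x hi hx; replace (q + S i)%nat with (S (q + i)) by lia; apply HUd; [lia|exact hx].
    - intros x hx; rewrite Nat.add_0_r.
      specialize (Hle x hx); specialize (H0 s x ltac:(split; lra) (Hsub x hx)).
      unfold U in *; lra. }
  apply hne; change (U O t0 = 0).
  assert (ht0' : segment a s t0) by (split; lra).
  specialize (Hz t0 ht0'); rewrite HUn in Hz by exact ht0'.
  rewrite <- (Rmult_1_l (U O t0)), <- (sgn_sq B), Rmult_assoc.
  apply Rmult_integral in Hz; destruct Hz as [Hz|Hz]; [lra|rewrite Hz; ring].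
Qed.

End Sign.

(** By uniqueness every Green's function agrees with the explicit one for interior s and t <> s, and
    this much suffices for subcriticality. *)
Lemma green_nonneg_iff n q a b A A' B mu :
  a < b -> splits n q A A' B ->
  green_derivative_nonneg n a b (- (sgn B * mu)) A B q <-> subcritical n a b A B mu.
Proof.
intros hab Hsp.
destruct (split_facts n q A A' B Hsp) as (hn & hlen & HA & HB & hq & _).
assert (HB' : forall i, In i B -> (i < n)%nat) by (intros i hi; specialize (HB i hi); lia).
split.
- intros [Hne [G [HG Hpos]]].
  destruct (bvp_inverse_exists n (sgn B * mu) a b A B ltac:(lia) hab hlen HA HB' Hne) as [T HT].
  apply (subcritical_of_response2_nonneg n q a b A A' B mu T hab Hsp HT).
  intros s t hs ht hts.
  rewrite <- (green_unique n (sgn B * mu) a b A B T hn hlen HA HB HT G Hne HG)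
    by (lia || assumption).
  apply Hpos; auto; split; lra.
- intros Hmu.
  pose proof (subcritical_not_eigenvalue n a b A B ltac:(lia) hab (proj1 (proj2 Hsp)) mu Hmu) as Hne.
  destruct (bvp_inverse_exists n (sgn B * mu) a b A B ltac:(lia) hab hlen HA HB' Hne) as [T HT].
  split; [exact Hne|].
  exists (fun i t s => response n (sgn B * mu) a b A B T 2 i s t); split.
  + now apply response2_green.
  + intros t s ht hs hts; apply (response2_nonneg n q a b A A' B mu T hab Hsp HT Hmu); auto.
Qed.

(** * Index counts and the conclusion *)

Lemma Sorted_lt_NoDup l : Sorted lt l -> NoDup l.
Proof.
intros H; apply Sorted_StronglySorted in H; [|intros x y z; apply Nat.lt_trans].
induction H as [|x l H IH Hx]; constructor; [|exact IH].
intros Hin; rewrite Forall_forall in Hx; specialize (Hx x Hin); lia.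
Qed.

Lemma count_lt_ge h l : (count_lt h l + count_ge h l = length l)%nat.
Proof.
unfold count_lt, count_ge; induction l as [|x l IH]; [reflexivity|]; simpl.
destruct (Nat.ltb_spec x h), (Nat.leb_spec h x); simpl; lia.
Qed.

Lemma count_lt_filter h q l :
  (h <= q)%nat -> count_lt h (filter (fun i => Nat.ltb i q) l) = count_lt h l.
Proof.
intros hq; unfold count_lt; induction l as [|x l IH]; [reflexivity|]; simpl.
destruct (Nat.ltb_spec x q); simpl; destruct (Nat.ltb_spec x h); simpl; lia.
Qed.

Lemma count_ge_full n q l :
  NoDup l -> (forall i, In i l -> (i < n)%nat) -> count_ge q l = (n - q)%nat ->
  forall i, (q <= i < n)%nat -> In i l.
Proof.
intros Hl Hn Hq i hi; apply NNPP; intros Hni.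
assert (Hstep : forall j k, (count_lt (j + k) l <= count_lt j l + k)%nat).
{ intros j k; induction k as [|k IH]; [rewrite Nat.add_0_r; lia|].
  rewrite Nat.add_succ_r, count_lt_S by exact Hl; destruct (mem _ l); simpl; lia. }
assert (Hi : count_lt (S i) l = count_lt i l).
{ rewrite count_lt_S by exact Hl; unfold mem; destruct in_dec; [contradiction|simpl; lia]. }
pose proof (Hstep q (i - q)%nat) as H1; pose proof (Hstep (S i) (n - S i)%nat) as H2.
replace (q + (i - q))%nat with i in H1 by lia.
replace (S i + (n - S i))%nat with n in H2 by lia.
rewrite (count_lt_all n l Hn) in H2; pose proof (count_lt_ge q l); lia.
Qed.

(** d_q = 0 puts all conditions at b below order q, and c_q = n - q fills the orders from q on at a.
    What remains has q conditions, and (N_a) carries over because the counts below h <= q are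
    unchanged. *)
Lemma splits_of_counts n k q sigma eps :
  (1 <= k <= n - 1)%nat -> increasing_indices n k sigma ->
  increasing_indices n (n - k) eps -> (1 <= q <= n - 1)%nat ->
  condition_Na n sigma eps -> count_ge q sigma = (n - q)%nat ->
  count_ge q eps = 0%nat ->
  splits n q sigma (filter (fun i => Nat.ltb i q) sigma) eps.
Proof.
intros hk (hsl & Hss & Hsn) (hel & Hes & Hen) hq HNa hc hd.
rewrite Forall_forall in Hsn, Hen.
assert (Hs : forall i, In i sigma -> (i < n)%nat) by (intros i hi; specialize (Hsn i hi); lia).
assert (He : forall i, In i eps -> (i < q)%nat).
{ intros i hi; unfold count_ge in hd; apply length_zero_iff_nil in hd.
  destruct (Nat.lt_ge_cases i q) as [|h]; [assumption|exfalso].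
  apply (in_nil (a := i)); rewrite <- hd; apply filter_In; split; [exact hi|].
  now apply Nat.leb_le. }
apply Sorted_lt_NoDup in Hss; apply Sorted_lt_NoDup in Hes.
split; [lia|split; [|split; [|split; [|split]]]].
- repeat split; auto; [intros i hi; specialize (He i hi); lia|lia].
- repeat split; auto.
  + now apply NoDup_filter.
  + intros i hi; apply filter_In in hi; now apply Nat.ltb_lt.
  + pose proof (count_lt_ge q sigma); unfold count_lt in *; lia.
  + intros h hh; rewrite count_lt_filter by lia; apply HNa; lia.
- intros i hi; now apply filter_In in hi.
- now apply count_ge_full.
- intros ->; simpl in hel; lia.
Qed.

Theorem theorem3p17 (n k q : nat) (a b : R) (sigma eps : list nat)
  (hn : (2 <= n)%nat) (hab : a < b) (hk : (1 <= k <= n - 1)%nat)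
  (hsigma : increasing_indices n k sigma)
  (heps : increasing_indices n (n - k) eps)
  (hq : (1 <= q <= n - 1)%nat)
  (hNa : condition_Na n sigma eps)
  (hcd : (count_ge q sigma + count_ge q eps = n - q)%nat)
  (hc : count_ge q sigma = (n - q)%nat)
  (hd : count_ge q eps = 0%nat) :
  (Nat.Even (n - k) ->
     exists lambda1 : R,
       biggest_negative_eigenvalue n a b sigma eps lambda1 /\
       forall M : R,
         green_derivative_nonneg n a b M sigma eps q <-> lambda1 < M <= 0) /\
  (Nat.Odd (n - k) ->
     exists lambda1 : R,
       least_positive_eigenvalue n a b sigma eps lambda1 /\
       forall M : R,
         green_derivative_nonneg n a b M sigma eps q <-> 0 <= M < lambda1).
Proof.
pose proof (splits_of_counts n k q sigma eps hk hsigma heps hq hNa hc hd) as Hsp.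
pose proof (proj1 (proj2 Hsp)) as Hadm.
pose proof (fun mu => green_nonneg_iff n q a b sigma _ eps mu hab Hsp) as Hiff.
destruct (first_eigenvalue n a b sigma eps ltac:(lia) hab Hadm
  (subcritical_bounded n q a b sigma _ eps hab Hsp)) as [mu1 [Heig Hsub]].
assert (hmu1 : 0 < mu1).
{ pose proof (subcritical_0 n a b sigma eps ltac:(lia) hab Hadm) as H; apply Hsub in H; lra. }
assert (Hfirst : forall mu, eigenvalue n a b sigma eps (- (sgn eps * mu)) -> 0 < mu -> mu1 <= mu).
{ intros mu He hmu; destruct (Rle_lt_dec mu1 mu); [assumption|exfalso].
  apply (subcritical_not_eigenvalue n a b sigma eps ltac:(lia) hab Hadm mu); [|exact He].
  apply Hsub; lra. }
assert (Hlen : length eps = (n - k)%nat) by apply heps.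
split; intros Hpar.
(* The eigenvalue parameter is -e mu, so the parity of n - k decides on which side of 0 the interval
   of M lies. *)
- assert (E : sgn eps = 1).
  { unfold sgn; rewrite Hlen; destruct Hpar as [m ->]; apply pow_1_even. }
  rewrite E in *; exists (- mu1); split; [split; [|split; [lra|]]|].
  + now replace (- mu1) with (- (1 * mu1)) by ring.
  + intros nu Hnu hneg; replace nu with (- (1 * - nu)) in Hnu by ring.
    specialize (Hfirst (- nu) Hnu ltac:(lra)); lra.
  + intros M; specialize (Hiff (- M)); replace (- (1 * - M)) with M in Hiff by ring.
    rewrite Hiff, Hsub; lra.
- assert (E : sgn eps = -1).
  { unfold sgn; rewrite Hlen; destruct Hpar as [m ->].
    replace (2 * m + 1)%nat with (S (2 * m)) by lia; apply pow_1_odd. }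
  rewrite E in *; exists mu1; split; [split; [|split; [lra|]]|].
  + now replace mu1 with (- (-1 * mu1)) by ring.
  + intros nu Hnu hpos; replace nu with (- (-1 * nu)) in Hnu by ring; auto.
  + intros M; specialize (Hiff M); replace (- (-1 * M)) with M in Hiff by ring.
    rewrite Hiff, Hsub; reflexivity.
Qed.
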